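(* The following decision problem is EXPTIME-hard: given a one-dimensional robot game $(U,V)$ and an initial counter value $x_0\in\mathbb{Z}$ (all integers encoded in binary), decide whether $x_0$ is a winning counter value, i.e. whether the reacher has a winning strategy from $x_0$.
   Context: A robot game in dimension one is a pair $(U,V)$ of finite nonempty subsets of $\mathbb{Z}$; $U$ belongs to the reacher and $V$ to the opponent. From an initial counter value $x_0\in\mathbb{Z}$, a play proceeds in rounds: in a round starting at counter value $x$, the opponent chooses $v\in V$ and the counter becomes $x+v$, then the reacher chooses $u\in U$ and the counter becomes $x+v+u$, where the round ends. The reacher wins the play if some round ends at $0$; by convention the reacher wins immediately if the play starts at $0$. Strategies are functions from play prefixes to moves. A counter value $x$ is winning if the reacher has a strategy such that, against every opponent strategy, the play from $x$ is won by the reacher. *)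

(* Defs.v *)
From mathcomp Require Import all_boot all_order all_algebra.
Set Implicit Arguments. Unset Strict Implicit. Unset Printing Implicit Defensive.
Import GRing.Theory Num.Theory.
Local Open Scope ring_scope.

(* A strategy maps a play prefix (the list of counter values visited so
   far, in chronological order, starting with the initial value) to a move. *)
Definition strategy := seq int -> int.

Fixpoint play (x0 : int) (sigma tau : strategy) (n : nat) : seq int :=
  match n with
  | 0%N => [:: x0]
  | n'.+1 =>
      let h := play x0 sigma tau n' in
      let x := last x0 h in
      let h' := rcons h (x + tau h) in
      rcons h' (x + tau h + sigma h')
  end.

(* Value at the end of round n (round 0 "ends" at the start x0). *)
Definition round_end (x0 : int) (sigma tau : strategy) (n : nat) : int :=
  last x0 (play x0 sigma tau n).

Definition winning (U V : seq int) (x0 : int) : Prop :=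
  exists sigma : strategy, (forall h, sigma h \in U) /\
    forall tau : strategy, (forall h, tau h \in V) ->
      exists n : nat, round_end x0 sigma tau n = 0.

Fixpoint bits_fuel (fuel n : nat) : seq bool :=
  match fuel with
  | 0%N => [::]
  | f.+1 => if n == 0%N then [::] else odd n :: bits_fuel f n./2
  end.
Definition bits (n : nat) : seq bool := bits_fuel n n.

(* self-delimiting: each bit b as [true; b], terminated by [false] *)
Definition enc_nat (n : nat) : seq bool :=
  flatten [seq [:: true; b] | b <- bits n] ++ [:: false].
Definition enc_int (z : int) : seq bool := (z < 0) :: enc_nat `|z|%N.
Definition enc_list (s : seq int) : seq bool :=
  flatten [seq true :: enc_int z | z <- s] ++ [:: false].
Definition enc_game (U V : seq int) (x0 : int) : seq bool :=
  enc_list U ++ enc_list V ++ enc_int x0.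

Definition language := seq bool -> Prop.

Definition ROBOT1 : language := fun w =>
  exists (U V : seq int) (x0 : int),
    [/\ U != [::], V != [::], w = enc_game U V x0 & winning U V x0].

(* States are 0..nstates-1 (0 = start, 1 = accept, 2 = reject, both    *)
(* halting); tape symbols are 0..nsyms-1 (0 = blank, 1 = bit false,     *)
(* 2 = bit true).                                                       *)

Inductive dir := DLeft | DRight | DStay.

Record TM := { tm_nstates : nat; tm_nsyms : nat;
               tm_delta : nat -> nat -> (nat * nat * dir) }.

Definition tm_wf (M : TM) : Prop :=
  [/\ (3 <= tm_nstates M)%N, (3 <= tm_nsyms M)%N &
      forall q s, (q < tm_nstates M)%N -> (s < tm_nsyms M)%N ->
        let: (q', s', _) := tm_delta M q s in
        (q' < tm_nstates M)%N /\ (s' < tm_nsyms M)%N].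

(* configuration: state, cells left of head (nearest first),
   cells from head rightwards (head cell first); missing cells are blank *)
Definition config := (nat * seq nat * seq nat)%type.

Definition tm_step (M : TM) (c : config) : config :=
  let: (q, l, r) := c in
  if (q == 1%N) || (q == 2%N) then c else
  let: (q', s', d) := tm_delta M q (head 0%N r) in
  match d with
  | DStay => (q', l, s' :: behead r)
  | DRight => (q', s' :: l, behead r)
  | DLeft => match l with
             | [::] => (q', [::], 0%N :: s' :: behead r)
             | a :: l' => (q', l', a :: s' :: behead r)
             end
  end.

Definition sym_of_bit (b : bool) : nat := if b then 2%N else 1%N.
Definition tm_init (w : seq bool) : config := (0%N, [::], map sym_of_bit w).
Definition tm_run (M : TM) (w : seq bool) (t : nat) : config :=
  iter t (tm_step M) (tm_init w).

Definition cfg_state (c : config) : nat := c.1.1.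
Definition cfg_output (c : config) : seq bool :=
  map (fun s => s == 2%N) (take (find (fun s => (s != 1%N) && (s != 2%N)) c.2) c.2).

Definition decides_in (M : TM) (L : language) (T : nat -> nat) : Prop :=
  forall w, let q := cfg_state (tm_run M w (T (size w))) in
    (q == 1%N \/ q == 2%N) /\ (q == 1%N <-> L w).

Definition computes_in (M : TM) (f : seq bool -> seq bool) (T : nat -> nat) : Prop :=
  forall w, let c := tm_run M w (T (size w)) in
    cfg_state c = 1%N /\ cfg_output c = f w.

Definition EXPTIME (L : language) : Prop :=
  exists (M : TM) (a k : nat), tm_wf M /\
    decides_in M L (fun n => 2 ^ (a * n ^ k + a))%N.

Definition poly_reduces (L1 L2 : language) : Prop :=
  exists (M : TM) (f : seq bool -> seq bool) (a k : nat),
    [/\ tm_wf M, computes_in M f (fun n => a * n ^ k + a)%N &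
        forall w, L1 w <-> L2 (f w)].

Definition EXPTIME_hard (L : language) : Prop :=
  forall L', EXPTIME L' -> poly_reduces L' L.

(* Main.v *)
Require Import Defs.
From HB Require Import structures.
From mathcomp Require Import all_boot all_order all_algebra.
From mathcomp Require Import zify ring.
From Stdlib Require Import ClassicalEpsilon.
Set Implicit Arguments. Unset Strict Implicit. Unset Printing Implicit Defensive.
Import GRing.Theory Num.Theory.

(* Fix a decider M running in time 2^p(n).  Its space-time tableau satisfies a
   local rule: the symbol at (t, i) is determined by the three symbols at
   (t-1, i-1), (t-1, i), (t-1, i+1).  In the game the reacher claims such a
   triple, the opponent picks one of its three members, and the reacher
   justifies that member by a triple one row below, until the bottom row is
   compared with the input.  Time, position and a finite control state are
   fields of the counter, and the opponent can do nothing but pick.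

   A counter has no control state, so cheating must be punished.  First, the
   opponent's move tau in {0..4} forces the reacher to answer from the menu tau:
   values are multiplied by 8, a reply from another menu leaves a nonzero residue
   modulo 8, and this residue can be kept nonzero for ever.  Second, control
   states are coded by powers of 16 modulo a constant N, so a transition b -> a
   played in a state other than b leaves the multiplicity -1 at b.  Two check
   menus send every running state to a winning state W_k, in which an honest
   reacher just walks down to 0, and contain no move into any state but W_k;
   if b <> W_k, the opponent plays the k-th check menu for ever and the
   multiplicity at b stays negative, so that 0 is never reached.

   All moves are numbers with a bounded number of digits in base 2^poly(n), each
   digit being constant or the index of an input position.  They are printed by
   a loop program, which a Turing machine runs one instruction per sweep of its
   tape. *)

(** * From menus to robot games *)

(** Hitting 0 exactly is the only test available, so every claim about the input becomes an equation
    on the counter. A claim about one input position is settled by one move, but a claim that a cell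
    is blank concerns an interval of positions: the reacher proves it by spending a fixed number of
    rounds, with one or two units of position in each (the states [SA]). The same test exposes blank
    claims made above the bottom row, because removing one unit of time would take [rho] such
    rounds, and the position field cannot pay for them. Modulo a power of 16, repeated cheats might
    cancel or wrap around. The most significant field, the level, excludes this: it is 2 in running
    states, 1 in winning states and 0 after a stop, and every check move that changes a multiplicity
    lowers it. Hence there are only a few such changes, all multiplicities stay below 16 in absolute
    value, and a residue 0 would force each of them to vanish. *)

Lemma round_endS (x0 : int) (sigma tau : strategy) (n : nat) :
  let h := play x0 sigma tau n in
  let x := (round_end x0 sigma tau n + tau h)%R in
  round_end x0 sigma tau n.+1 = (x + sigma (rcons h x))%R.
Proof. by rewrite /round_end /= last_rcons. Qed.

Section MenuGame.

Variables (menu : nat -> seq nat) (U : seq int).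
Hypothesis U_menu : forall u : int, u \in U <->
  exists tau m, [/\ tau < 5, m \in menu tau & u = (- (Posz (8 * m + tau)))%R].

Let V : seq int := [:: 0; 1; 2; 3; 4]%R.

Lemma mem_V (v : int) : v \in V <-> exists2 tau, tau < 5 & v = (Posz tau).
Proof.
rewrite !inE; split; last by case=> -[|[|[|[|[|t]]]]] // _ ->.
by case/or4P=> [/eqP->|/eqP->|/eqP->|/orP[]/eqP->];
  [exists 0|exists 1|exists 2|exists 3|exists 4].
Qed.

(** The strategy is memoryless: since [tau < 5 < 8], the counter [8 * y + tau] in the middle of a
    round determines both [y] and [tau]. It wins because [y] strictly decreases. *)
Lemma menu_game_complete (Good : nat -> Prop) (y0 : nat) :
  (forall y, Good y -> y = 0 \/ forall tau, tau < 5 ->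
     exists m, [/\ m \in menu tau, 0 < m <= y & Good (y - m)]) ->
  (exists u, u \in U) -> Good y0 -> winning U V (Posz (8 * y0)).
Proof.
move=> good_step [u0 Uu0] good0.
(* [P x u] is vacuous unless [x] is a mid-round counter with a good reply, so that a move can be
   chosen for every [x]. *)
pose P (x u : int) := forall y tau m', x = (Posz (8 * y + tau)) -> tau < 5 ->
  [/\ m' \in menu tau, 0 < m' <= y & Good (y - m')] ->
  exists m, [/\ m \in menu tau, 0 < m <= y, Good (y - m) & u = (- (Posz (8 * m + tau)))%R].
have exP x : exists u, u \in U /\ P x u.
  case: (classic (exists y tau m, [/\ x = (Posz (8 * y + tau)), tau < 5 &
    [/\ m \in menu tau, 0 < m <= y & Good (y - m)]])) => [|no].
    case=> y [tau [m [ex lt5 [mm lem gm]]]].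
    exists (- (Posz (8 * m + tau)))%R; split; first by apply/U_menu; exists tau, m.
    move=> y' tau' m' ex' lt5' _.
    have [ey et] : y' = y /\ tau' = tau by lia.
    by subst; exists m.
  by exists u0; split=> // y tau m ex lt5 H; case: no; exists y, tau, m.
pose choose x := proj1_sig (constructive_indefinite_description _ (exP x)).
have chooseP x : choose x \in U /\ P x (choose x).
  exact: (proj2_sig (constructive_indefinite_description _ (exP x))).
pose sigma (h : seq int) := choose (last 0%R h).
exists sigma; split=> [h|tau Vtau]; first by case: (chooseP (last 0%R h)).
have main n : (exists n', round_end (Posz (8 * y0)) sigma tau n' = 0%R) \/
   exists y, [/\ round_end (Posz (8 * y0)) sigma tau n = (Posz (8 * y)), Good y & y + n <= y0].
  elim: n => [|n [|[y [ey gy ley]]]]; [|by left|].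
    by right; exists y0; rewrite addn0.
  case: (good_step y gy) => [y00|step]; first by left; exists n; rewrite ey y00.
  have /mem_V[t lt5 et] := Vtau (play (Posz (8 * y0)) sigma tau n).
  right; have := round_endS (Posz (8 * y0)) sigma tau n.
  rewrite /= ey et => ->; rewrite /sigma last_rcons.
  have -> : (Posz (8 * y) + Posz t)%R = Posz (8 * y + t) by lia.
  have [_ Px] := chooseP (Posz (8 * y + t)); have [m' mP] := step t lt5.
  have [m [mm lem gm ->]] := Px _ _ _ erefl lt5 mP.
  by exists (y - m); split => //; rewrite /sigma; lia.
by case: (main y0.+1) => // -[y [_ _]]; lia.
Qed.

Lemma menu_game_sound (Bad : nat -> Prop) (y0 : nat) :
  (forall y, Bad y -> y != 0 /\ exists tau, tau < 5 /\
     forall m, m \in menu tau -> m <= y -> Bad (y - m)) ->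
  Bad y0 -> ~ winning U V (Posz (8 * y0)).
Proof.
move=> bad_step bad0 [sigma [Usigma win]].
(* Once the residue modulo 8 is nonzero the opponent keeps it nonzero for
   ever: he moves it into {5, 6, 7}, and the reacher subtracts at most 4. *)
pose Inv (x : int) := [\/ (forall y : int, x <> 8 * y)%R, (x < 0)%R |
   exists2 y, x = (Posz (8 * y)) & Bad y].
have exP x : exists v, v \in V /\ (Inv x -> forall u, u \in U -> Inv (x + v + u)%R).
  case: (classic (exists y : int, x = 8 * y)%R) => [[y ex]|nx]; last first.
    have [v [lev Hv]] : exists v, v < 5 /\ (5 <= ((x + (Posz v))%R %% 8)%Z)%R.
      have : ((x %% 8)%Z != 0)%R.
        by apply/eqP => x0; case: nx; exists (x %/ 8)%Z; lia.
      move=> r0.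
      exists (if (x %% 8 < 5)%Z%R then 5 - absz (x %% 8)%Z else 0).
      by case: ifP; lia.
    exists (Posz v); split; first by apply/mem_V; exists v.
    by move=> _ u /U_menu[tau [m [lt5 _ ->]]]; constructor 1; lia.
  case: (classic (exists2 y, x = (Posz (8 * y)) & Bad y)) => [[y' ex' by']|nb].
    have [_ [tau [lt5 step]]] := bad_step _ by'.
    exists (Posz tau); split; first by apply/mem_V; exists tau.
    move=> _ u /U_menu[tau' [m [lt5' mm ->]]].
    case: (eqVneq tau' tau) => [et|ne]; last by constructor 1; lia.
    subst tau'; case: (leqP m y') => [le|lt]; last by constructor 2; lia.
    by constructor 3; exists (y' - m); [lia|apply: step].
  (* Here only negative multiples of 8 satisfy [Inv]. After the opponent's 0, a reply from menu 0
     keeps the value negative and any other reply breaks divisibility by 8. *)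
  exists 0%R; split; first by apply/mem_V; exists 0.
  case=> [/(_ y)//|xn|//] u /U_menu[tau [m [lt5 _ ->]]].
  by case: (eqVneq tau 0) => [->|ne]; [constructor 2|constructor 1]; lia.
pose choose x := proj1_sig (constructive_indefinite_description _ (exP x)).
have chooseP x : choose x \in V /\ (Inv x -> forall u, u \in U -> Inv (x + choose x + u)%R).
  exact: (proj2_sig (constructive_indefinite_description _ (exP x))).
pose tau (h : seq int) := choose (last (Posz (8 * y0)) h).
have [n] := win tau (fun h => proj1 (chooseP _)).
have: Inv (round_end (Posz (8 * y0)) sigma tau n).
  elim: n => [|n IH]; first by constructor 3; exists y0.
  rewrite round_endS /tau -/(round_end _ _ _ _).
  by apply: (proj2 (chooseP _)) => //; apply: Usigma.
case=> [/(_ 0%R)|lt0|[y -> /bad_step[]]] //; last by lia.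
by move=> e; rewrite e in lt0.
Qed.

End MenuGame.

(** * The moves of the tableau game *)

Lemma base16_head (x s a : int) : (x + 16 * s = 16 * a)%R -> `|x|%N < 16 -> x = 0%R.
Proof. lia. Qed.

Lemma base16_tail (s a : int) : (0 + 16 * s = 16 * a)%R -> s = a.
Proof. lia. Qed.

(** The lowest digit is divisible by 16, hence 0, and the rest can be divided by 16. This is how a
    residue modulo [modulus G] reveals all multiplicities, negative ones included. *)
Lemma base16_eq0 (K : nat) (v : nat -> int) :
  (forall j, `|v j|%N < 16) ->
  (exists z, \sum_(j < K) v j * 16 ^+ j = Posz (16 ^ K)%N * z)%R ->
  forall j, j < K -> v j = 0%R.
Proof.
elim: K v => [|K IH] v bv [z ez] // .
have sumE : (\sum_(j < K.+1) v j * 16 ^+ j = v 0 + 16 * \sum_(j < K) v j.+1 * 16 ^+ j)%R.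
  rewrite big_ord_recl /= expr0 mulr1; congr (_ + _)%R.
  rewrite mulr_sumr; apply: eq_bigr => i _.
  by rewrite exprS mulrCA.
rewrite sumE in ez; move: ez; set S := (\sum_(_ < _) _)%R => ez.
have v0 : v 0 = 0%R.
  by move: ez; rewrite expnS PoszM -mulrA => /base16_head; apply.
case=> [_|j ltj]; first exact: v0.
apply: (IH (fun j => v j.+1)) => //; exists z.
by move: ez; rewrite v0 expnS PoszM -mulrA => /base16_tail.
Qed.

(* [SW]: the reacher has answered a check and only has to walk down to 0;
   [SA]: a range test, see [awin]; [SF x]: the claim that the input carries [x]
   at the current position, [None] standing for the blanks to the right of the
   input; [ST]: a claimed triple.  The booleans make the source and the target of
   every run move distinct. *)
Inductive gstate (G : Type) :=
  | SW of bool
  | SA of bool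
  | SF of option bool
  | ST of bool * (G * G * G).
Arguments SW {G}. Arguments SA {G}. Arguments SF {G}. Arguments ST {G}.

(** A stopped play, coded by [None], gets level 0 through [odflt0]. Thus entering [SW] from above
    and stopping in [SW] cost one level each. *)
Definition level (G : Type) (s : gstate G) : nat := if s is SW _ then 1 else 2.

Definition proj3 (G : Type) (d : nat) (x : G * G * G) : G :=
  match d with 0 => x.1.1 | 1 => x.1.2 | _ => x.2 end.

(* The coefficients of [mshift] below; [mi] switches on the input position that
   the printer is at when it writes the move. *)
Record move (G : Type) := Move {
  msrc : gstate G; mdst : option (gstate G);
  m0 : nat; mi : bool; me : nat; mQ : nat; mQe : nat; mT : nat }.

Section Rank.

Variable G : finType.

(** The order matters: [SW] is lowest and [SA] comes before [SF], so that a move with [m0 = 0]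
    either stops or leads to a smaller code, and its lowest digit is a natural number. *)
Definition rank (s : gstate G) : nat :=
  match s with
  | SW k => k
  | SA a => 2 + a
  | SF x => 4 + (if x is Some b then b.+1 else 0)
  | ST p => 7 + enum_rank p
  end.

Definition nranks := 7 + #|{: bool * (G * G * G)}|.

Lemma rank_lt s : rank s < nranks.
Proof.
by case: s => [[]|[]|[[]|]|p]; rewrite /nranks /= ?ltn_add2l //; apply: ltn_ord.
Qed.

Lemma rank_inj : injective rank.
Proof.
move=> [[]|[]|[[]|]|p] [[]|[]|[[]|]|q] //= H; try by move: H; lia.
by congr ST; apply: enum_rank_inj; apply: val_inj => /=; lia.
Qed.

Definition code (s : gstate G) := 16 ^ rank s.
Definition modulus := 16 ^ nranks.

Lemma code_lt s : code s < modulus.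
Proof. by rewrite /code /modulus ltn_exp2l // rank_lt. Qed.

End Rank.

HB.instance Definition _ (G : finType) := Equality.copy (gstate G) (inj_type (@rank_inj G)).

Definition move_tuple (G : Type) (m : move G) :=
  (msrc m, mdst m, (m0 m, mi m, me m), (mQ m, mQe m, mT m)).

Lemma move_tuple_inj (G : Type) : injective (@move_tuple G).
Proof. by move=> [? ? ? ? ? ? ? ?] [? ? ? ? ? ? ? ?] [<- <- <- <- <- <- <- <-]. Qed.

HB.instance Definition _ (G : finType) := Equality.copy (move G) (inj_type (@move_tuple_inj G)).

Section Tableau.

Variable G : finType.
Variables (g : G -> G -> G -> G) (sstart sblk : G) (sbit : bool -> G).

Definition odflt0 (f : gstate G -> nat) (s : option (gstate G)) := if s is Some s then f s else 0.

Definition rule3 (x : G * G * G) := g x.1.1 x.1.2 x.2.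
Definition fsym (x : option bool) : G := if x is Some b then sbit b else sblk.

Definition bools := [:: false; true].
Definition obools := [:: None; Some false; Some true].
Definition triples := enum {: bool * (G * G * G)}.
Definition upper_states : seq (gstate G) :=
  map SA bools ++ map SF obools ++ map ST triples.

(** For a content [place t i], let [i' = i + d - 1] be the cell to justify. One row down the drift
    drops by 2, so reaching [i'] costs [3 - d] besides [T]. On the bottom row, [5 - d] leaves
    [i' + 4 * e + 2 * (Q * e)], the exit to [SA] leaves [i' + 4 * e + 2 + 2 * (Q * e)], and the
    start move leaves [i' + 1], which is 0 exactly at the marker. *)
Definition run_moves (d : nat) : seq (move G) :=
  flatten [seq [seq Move (ST p) (Some (ST (~~ p.1, q))) (3 - d) false 0 0 0 1
               | q <- enum {: G * G * G} & rule3 q == proj3 d p.2] | p <- triples] ++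
  flatten [seq [seq Move (ST p) (Some (SF x)) (5 - d) false 0 0 0 0
               | x <- obools & fsym x == proj3 d p.2] | p <- triples] ++
  [seq Move (ST p) (Some (SA false)) (3 - d) false 0 0 0 0
       | p <- triples & sblk == proj3 d p.2] ++
  [seq Move (ST p) None (4 - d) false 4 0 2 0 | p <- triples & sstart == proj3 d p.2] ++
  flatten [seq [seq Move (SA a) (Some (SA (~~ a))) j false 0 1 0 0 | j <- [:: 1; 2]] | a <- bools] ++
  [seq Move (SA a) None 0 false 0 0 0 0 | a <- bools] ++
  [seq Move (SW k) (Some (SW (~~ k))) 1 false 0 0 0 0 | k <- bools] ++
  [seq Move (SW k) None 0 false 0 0 0 0 | k <- bools].

(** Walking down must not toggle here: a self-loop leaves all multiplicities unchanged, whereas a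
    move into the other winning state could repair a cheat there. *)
Definition check_moves (k : bool) : seq (move G) :=
  [seq Move s (Some (SW k)) 0 false 0 0 0 0 | s <- upper_states] ++
  [seq Move (SW j) (Some (SW j)) 1 false 0 0 0 0 | j <- bools] ++
  [seq Move (SW j) None 0 false 0 0 0 0 | j <- bools].

Definition const_moves (tau : nat) : seq (move G) :=
  if tau < 3 then run_moves tau else check_moves (tau == 4).

Definition bit_moves (tau : nat) (b : bool) : seq (move G) :=
  if tau < 3 then [:: Move (SF (Some b)) None 0 true 4 0 2 0] else [::].

Definition blank_moves (tau : nat) : seq (move G) :=
  if tau < 3 then [:: Move (SF None) (Some (SA false)) 0 true 2 0 0 0] else [::].

Section Numbers.

Variables (e Q T B : nat).

Definition mshift (i : nat) (m : move G) : nat :=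
  m0 m + mi m * i + me m * e + mQ m * Q + mQe m * (Q * e) + mT m * T.

(** A play in state [s] with content [c] has counter [8 * (level s * B + code s + modulus G * c)]
    between rounds. [mag] is the decrease, divided by 8, when the state becomes [t] and the content
    drops by [h]. For the moves that occur the subtraction is not truncated, see [mag_pos]. *)
Definition mag (s : gstate G) t h :=
  level s * B + code s + modulus G * h - (odflt0 (@level G) t * B + odflt0 (@code G) t).

Definition mmag i m := mag (msrc m) (mdst m) (mshift i m).

Definition tableau_menu (w : seq bool) (tau : nat) : seq nat :=
  [seq mmag 0 m | m <- const_moves tau] ++
  flatten [seq [seq mmag k m | m <- bit_moves tau (nth false w k)] | k <- iota 0 (size w)] ++
  [seq mmag (size w) m | m <- blank_moves tau].

Inductive run_move (w : seq bool) (d : nat) : gstate G -> option (gstate G) -> nat -> Prop :=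
  | RunStep p q of rule3 q = proj3 d p.2 :
      run_move w d (ST p) (Some (ST (~~ p.1, q))) (3 - d + T)
  | RunClaim p x of fsym x = proj3 d p.2 : run_move w d (ST p) (Some (SF x)) (5 - d)
  | RunLeft p of sblk = proj3 d p.2 : run_move w d (ST p) (Some (SA false)) (3 - d)
  | RunStart p of sstart = proj3 d p.2 : run_move w d (ST p) None (4 - d + 4 * e + 2 * (Q * e))
  | RunToggle a j of j \in [:: 1; 2] : run_move w d (SA a) (Some (SA (~~ a))) (j + Q)
  | RunDone a : run_move w d (SA a) None 0
  | RunWin k : run_move w d (SW k) (Some (SW (~~ k))) 1
  | RunWon k : run_move w d (SW k) None 0
  | RunBit k of k < size w :
      run_move w d (SF (Some (nth false w k))) None (k + 4 * e + 2 * (Q * e))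
  | RunRight : run_move w d (SF None) (Some (SA false)) (size w + 2 * e).

Lemma mem_run_menu w d m : d < 3 ->
  m \in tableau_menu w d <-> exists s t h, run_move w d s t h /\ m = mag s t h.
Proof.
move=> lt3; rewrite /tableau_menu /const_moves /bit_moves /blank_moves lt3; split.
  rewrite mem_cat => /orP[/mapP[mv]|].
    rewrite mem_cat => /orP[/flatten_mapP[p _ /mapP[q]]|].
      rewrite mem_filter => /andP[/eqP E _] -> ->.
      exists (ST p), (Some (ST (~~ p.1, q))), (3 - d + T); split; first exact: RunStep.
      by rewrite /mmag /mshift /=; congr mag; lia.
    rewrite mem_cat => /orP[/flatten_mapP[p _ /mapP[x]]|].
      rewrite mem_filter => /andP[/eqP E _] -> ->.
      exists (ST p), (Some (SF x)), (5 - d); split; first exact: RunClaim.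
      by rewrite /mmag /mshift /=; congr mag; lia.
    rewrite mem_cat => /orP[/mapP[p]|].
      rewrite mem_filter => /andP[/eqP E _] -> ->.
      exists (ST p), (Some (SA false)), (3 - d); split; first exact: RunLeft.
      by rewrite /mmag /mshift /=; congr mag; lia.
    rewrite mem_cat => /orP[/mapP[p]|].
      rewrite mem_filter => /andP[/eqP E _] -> ->.
      exists (ST p), None, (4 - d + 4 * e + 2 * (Q * e)); split; first exact: RunStart.
      by rewrite /mmag /mshift /=; congr mag; lia.
    rewrite mem_cat => /orP[/flatten_mapP[a _ /mapP[j jin]]|].
      move=> -> ->.
      exists (SA a), (Some (SA (~~ a))), (j + Q); split; first exact: RunToggle.
      by rewrite /mmag /mshift /=; congr mag; lia.
    rewrite mem_cat => /orP[/mapP[a _] -> ->|].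
      by exists (SA a), None, 0; split; first exact: RunDone.
    rewrite mem_cat => /orP[/mapP[k _] -> ->|/mapP[k _] -> ->].
      by exists (SW k), (Some (SW (~~ k))), 1; split; first exact: RunWin.
    by exists (SW k), None, 0; split; first exact: RunWon.
  rewrite mem_cat => /orP[/flatten_mapP[k]|].
    rewrite mem_iota add0n /= inE => ltk /eqP ->.
    exists (SF (Some (nth false w k))), None, (k + 4 * e + 2 * (Q * e)); split; first exact: RunBit.
    by rewrite /mmag /mshift /=; congr mag; lia.
  rewrite inE => /eqP ->.
  exists (SF None), (Some (SA false)), (size w + 2 * e); split; first exact: RunRight.
  by rewrite /mmag /mshift /=; congr mag; lia.
have inb (b : bool) : b \in bools by case: b.
have ino (x : option bool) : x \in obools by case: x => [[]|].
have inT (p : bool * (G * G * G)) : p \in triples by rewrite mem_enum.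
have incl (mv : move G) s t h : mv \in run_moves d -> msrc mv = s -> mdst mv = t ->
  mshift 0 mv = h -> mag s t h \in [seq mmag 0 m | m <- run_moves d].
  by move=> mvin <- <- <-; apply: map_f.
move=> [s [t [h [[]]]]]; rewrite mem_cat.
- move=> p q E ->; apply/orP; left.
  apply: (incl (Move (ST p) (Some (ST (~~ p.1, q))) (3 - d) false 0 0 0 1)) => //; last first.
    by rewrite /mshift /=; lia.
  rewrite mem_cat; apply/orP; left; apply/flatten_mapP; exists p => //.
  by apply/mapP; exists q => //; rewrite mem_filter E eqxx mem_enum.
- move=> p x E ->; apply/orP; left.
  apply: (incl (Move (ST p) (Some (SF x)) (5 - d) false 0 0 0 0)) => //; last first.
    by rewrite /mshift /=; lia.
  rewrite mem_cat; apply/orP; right.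
  rewrite mem_cat; apply/orP; left; apply/flatten_mapP; exists p => //.
  by apply/mapP; exists x => //; rewrite mem_filter E eqxx ino.
- move=> p E ->; apply/orP; left.
  apply: (incl (Move (ST p) (Some (SA false)) (3 - d) false 0 0 0 0)) => //; last first.
    by rewrite /mshift /=; lia.
  do 2![rewrite mem_cat; apply/orP; right].
  rewrite mem_cat; apply/orP; left.
  by apply/mapP; exists p => //; rewrite mem_filter E eqxx inT.
- move=> p E ->; apply/orP; left.
  apply: (incl (Move (ST p) None (4 - d) false 4 0 2 0)) => //; last first.
    by rewrite /mshift /=; lia.
  do 3![rewrite mem_cat; apply/orP; right].
  rewrite mem_cat; apply/orP; left.
  by apply/mapP; exists p => //; rewrite mem_filter E eqxx inT.
- move=> a j jin ->; apply/orP; left.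
  apply: (incl (Move (SA a) (Some (SA (~~ a))) j false 0 1 0 0)) => //; last first.
    by rewrite /mshift /=; lia.
  do 4![rewrite mem_cat; apply/orP; right].
  rewrite mem_cat; apply/orP; left.
  by apply/flatten_mapP; exists a => //; apply/mapP; exists j.
- move=> a ->; apply/orP; left.
  apply: (incl (Move (SA a) None 0 false 0 0 0 0)) => //.
  do 5![rewrite mem_cat; apply/orP; right].
  by rewrite mem_cat; apply/orP; left; apply/mapP; exists a.
- move=> k ->; apply/orP; left.
  apply: (incl (Move (SW k) (Some (SW (~~ k))) 1 false 0 0 0 0)) => //.
  do 6![rewrite mem_cat; apply/orP; right].
  by rewrite mem_cat; apply/orP; left; apply/mapP; exists k.
- move=> k ->; apply/orP; left.
  apply: (incl (Move (SW k) None 0 false 0 0 0 0)) => //.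
  do 6![rewrite mem_cat; apply/orP; right].
  by rewrite mem_cat; apply/orP; right; apply/mapP; exists k.
- move=> k ltk ->; apply/orP; right; rewrite mem_cat; apply/orP; left.
  apply/flatten_mapP; exists k; first by rewrite mem_iota add0n.
  rewrite inE /mmag /=; apply/eqP; congr mag; rewrite /mshift /=; lia.
- move=> ->; apply/orP; right; rewrite mem_cat; apply/orP; right.
  rewrite inE /mmag /=; apply/eqP; congr mag; rewrite /mshift /=; lia.
Qed.

Inductive check_move (k : bool) : gstate G -> option (gstate G) -> nat -> Prop :=
  | CheckDrop s of level s = 2 : check_move k s (Some (SW k)) 0
  | CheckWalk j : check_move k (SW j) (Some (SW j)) 1
  | CheckWon j : check_move k (SW j) None 0.

Lemma mem_check_menu w (k : bool) m :
  m \in tableau_menu w (3 + k) <-> exists s t h, check_move k s t h /\ m = mag s t h.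
Proof.
have -> : tableau_menu w (3 + k) = [seq mmag 0 m | m <- check_moves k].
  rewrite /tableau_menu /const_moves /bit_moves /blank_moves.
  rewrite (_ : (3 + k < 3) = false) // (_ : (3 + k == 4) = k); last by case: k.
  rewrite -[RHS]cats0; congr (_ ++ _).
  by elim: (iota _ _).
have inb (b : bool) : b \in bools by case: b.
have ino (x : option bool) : x \in obools by case: x => [[]|].
have inT (p : bool * (G * G * G)) : p \in triples by rewrite mem_enum.
split.
  case/mapP=> mv; rewrite mem_cat => /orP[/mapP[s sin] -> ->|].
    exists s, (Some (SW k)), 0; split => //; apply: CheckDrop.
    by move: sin; rewrite !mem_cat => /or3P[]/mapP[? _ ->].
  rewrite mem_cat => /orP[]/mapP[j _] -> ->.
    by exists (SW j), (Some (SW j)), 1; split; first exact: CheckWalk.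
  by exists (SW j), None, 0; split; first exact: CheckWon.
case=> s [t [h [[]]]].
- move=> {}s l2 ->; apply/mapP; exists (Move s (Some (SW k)) 0 false 0 0 0 0) => //.
  rewrite mem_cat; apply/orP; left; apply: (map_f (fun s => Move s (Some (SW k)) 0 false 0 0 0 0)).
  by rewrite !mem_cat; apply/or3P; case: s l2 => // x _;
    [apply: Or31|apply: Or32|apply: Or33]; apply: map_f.
- move=> j ->; apply/mapP; exists (Move (SW j) (Some (SW j)) 1 false 0 0 0 0) => //.
  rewrite mem_cat; apply/orP; right; rewrite mem_cat; apply/orP; left.
  by apply/mapP; exists j.
- move=> j ->; apply/mapP; exists (Move (SW j) None 0 false 0 0 0 0) => //.
  rewrite mem_cat; apply/orP; right; rewrite mem_cat; apply/orP; right.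
  by apply/mapP; exists j.
Qed.

End Numbers.
End Tableau.

(** * The tableau game *)

Section TableauGame.

Variable G : finType.
Variables (g : G -> G -> G -> G) (sstart sblk : G) (sbit : bool -> G).
Variables (e Q rho B' : nat) (w : seq bool).

(** These bounds keep the fields from interacting: positions stay below [rho], the one or two units
    spent per round of a range test never add up to [Q], and [B'] exceeds the initial content. *)
Hypothesis e_gt0 : 0 < e.
Hypothesis size_w : size w <= e.
Hypothesis rho_ge : 16 * e <= rho.
Hypothesis Q_ge : 8 * (rho * e) <= Q.

Let T := rho * Q.
Let B := modulus G * B'.
Let n := size w.

Hypothesis B'_ge : T * e + 16 * e + 2 * (Q * e) < B'.

(** Row 0 shows only the raw input, because a bottom-row claim can be compared with nothing else;
    the marker at -1 tells the local rule where the head starts. *)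
Definition tab_row0 (i : int) : G :=
  match i with
  | Posz k => nth sblk (map sbit w) k
  | Negz 0 => sstart
  | Negz _ => sblk
  end.

Fixpoint tab_row (t : nat) (i : int) : G :=
  if t is t'.+1 then g (tab_row t' (i - 1)%R) (tab_row t' i) (tab_row t' (i + 1)%R) else tab_row0 i.

Definition tab_row3 (t : nat) (i : int) := (tab_row t (i - 1)%R, tab_row t i, tab_row t (i + 1)%R).

Lemma rule_tab_row3 t i : rule3 g (tab_row3 t i) = tab_row t.+1 i.
Proof. by []. Qed.

Lemma proj_tab_row3 d t i : d < 3 -> proj3 d (tab_row3 t i) = tab_row t (i + Posz d - 1)%R.
Proof.
by case: d => [|[|[|]]] //= _; congr tab_row; lia.
Qed.

Lemma tab_row0_pos k : k < n -> tab_row0 (Posz k) = sbit (nth false w k).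
Proof. by move=> lt; rewrite /= (nth_map false). Qed.

Lemma tab_row0_ge k : n <= k -> tab_row0 (Posz k) = sblk.
Proof. by move=> le; rewrite /= nth_default // size_map. Qed.

Lemma tab_row0_lt i : (i < -1)%R -> tab_row0 i = sblk.
Proof. by case: i => // -[]. Qed.

Let N := modulus G.

Lemma N_gt0 : 0 < N. Proof. by rewrite /N /modulus expn_gt0. Qed.

Lemma code_gt0 (s : gstate G) : 0 < code s. Proof. by rewrite /code expn_gt0. Qed.

Definition levelo (t : option (gstate G)) := odflt0 (@level G) t.
Definition codeo (t : option (gstate G)) := odflt0 (@code G) t.

Definition base (t : option (gstate G)) := levelo t * B + codeo t.

Lemma magE s t h : base t <= base (Some s) + N * h ->
  mag B s t h + base t = base (Some s) + N * h.
Proof. by rewrite /mag /base /= => /subnK. Qed.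

Lemma B'_gt0 : 0 < B'. Proof. by apply: leq_ltn_trans B'_ge. Qed.

Lemma codeo_lt t : codeo t < N.
Proof. by case: t => [s|] /=; [apply: code_lt|apply: N_gt0]. Qed.

(** That a run move never loops is what makes a wrong source visible; the rest makes its magnitude
    positive. *)
Lemma run_move_shape d s t h : run_move g sstart sblk sbit e Q T w d s t h -> d < 3 ->
  t <> Some s /\ (t = None \/ levelo t = level s /\ 0 < h).
Proof.
case=> [p q _|p x _|p _|p _|a j jin|a|k|k|k _|] lt3; split => //; try (by left);
  try (by right; split => //; lia).
- by case=> E; move: (congr1 fst E) => /=; case: (p.1).
- by case; case: a.
- by right; split => //; move: jin; rewrite !inE => /orP[]/eqP->.
- by case; case: k.
Qed.

(** At equal level, [N * h >= N] already exceeds any code; a lower level frees a whole [B], which is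
    at least [N]. *)
Lemma mag_pos s t h :
  t = None \/ level s = levelo t /\ 0 < h \/ levelo t < level s ->
  0 < mag B s t h /\ mag B s t h + base t = base (Some s) + N * h.
Proof.
move=> sh; have lt : base t < base (Some s) + N * h.
  rewrite /base; have := codeo_lt t; have := B'_gt0; have := code_gt0 s.
  case: sh => [->|[[/= -> h0]|]] /=.
  - by rewrite /levelo /=; lia.
  - have : N <= N * h by rewrite leq_pmulr.
    by rewrite /levelo /=; lia.
  - rewrite /B -/N; have := N_gt0; set L := level s; set L' := levelo t => ? L1 ? ? ?.
    have : L' * (N * B') + N * B' <= L * (N * B') by rewrite -mulSnr leq_mul2r L1 orbT.
    have : N <= N * B' by rewrite leq_pmulr // B'_gt0.
    by rewrite /levelo /=; lia.
have E := magE (ltnW lt); split => //.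
by rewrite -(ltn_add2r (base t)) add0n E.
Qed.

Lemma run_move_mag d s t h : run_move g sstart sblk sbit e Q T w d s t h -> d < 3 ->
  0 < mag B s t h /\ mag B s t h + base t = base (Some s) + N * h.
Proof.
move=> mv lt3; have [_ sh] := run_move_shape mv lt3; apply: mag_pos.
by case: sh => [|[]]; [left|right; left].
Qed.

Lemma check_move_mag k s t h : check_move k s t h ->
  0 < mag B s t h /\ mag B s t h + base t = base (Some s) + N * h.
Proof.
by move=> mv; apply: mag_pos; case: mv => [{}s l2|j|j]; [right; right; rewrite l2|right; left|left].
Qed.

(* Each round in [SA] costs [Q] and in addition 1 or 2 at the choice of the
   reacher, so it ends exactly at 0 iff [c] is [m + Q * f] with these bounds. *)
Definition awin (c : int) := exists f m : nat, f <= m <= 2 * f /\ c = Posz (m + Q * f).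

(* Thanks to the drift [2 * t] the three cells below are at distance 1, 2 and 3
   to the left, so that all moves decrease the counter. *)
Definition place (t : nat) (i : int) : int :=
  (i + Posz (2 * t + 4 * e + 4 + T * t + 2 * (Q * e)))%R.

(** The bound [t + |i| <= e] survives a descent, which moves by at most one cell, and keeps
    positions in the range on which the fields are separated. *)
Definition good (s : gstate G) (c : nat) : Prop :=
  match s with
  | SW _ => True
  | SA _ => awin c
  | SF (Some b) => exists k, [/\ k < n, nth false w k = b & c = k + 4 * e + 2 * (Q * e)]
  | SF None => exists2 c', c = n + 2 * e + c' & awin c'
  | ST p => exists t i, [/\ t + `|i|%N <= e, Posz c = place t i & p.2 = tab_row3 t i]
  end.

Lemma good_run d s c : d < 3 -> good s c -> exists t h c',
  [/\ run_move g sstart sblk sbit e Q T w d s t h, c = c' + h &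
     if t is Some s' then good s' c' else c' = 0].
Proof.
move=> lt3; case: s => [k|a|[b|]|p] /=.
- case: c => [|c] _; first by exists None, 0, 0; split => //; apply: RunWon.
  by exists (Some (SW (~~ k))), 1, c; split; [apply: RunWin|rewrite addn1|].
- case=> -[|f] [m [/andP[le1 le2] [ec]]].
    by exists None, 0, 0; split => //; [apply: RunDone|lia].
  (* A toggle takes 1 or 2 from [m]; when [f < m <= 2 * f + 2], one of the two choices restores
     [f <= m - j <= 2 * f]. *)
  have [j [jin jle1 jle2]] : exists j, [/\ j \in [:: 1; 2], f <= m - j <= 2 * f & j <= m].
    case: (leqP (m - 1) (2 * f)) => le3; first by exists 1; split; rewrite ?inE //; lia.
    by exists 2; split; rewrite ?inE //; lia.
  exists (Some (SA (~~ a))), (j + Q), (m - j + Q * f); split; first exact: RunToggle.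
    by rewrite ec mulnS; lia.
  by exists f, (m - j).
- case=> k [ltk <- ->]; exists None, (k + 4 * e + 2 * (Q * e)), 0; split => //.
  exact: RunBit.
- case=> c' -> aw; exists (Some (SA false)), (n + 2 * e), c'; split => //.
    exact: RunRight.
  by rewrite addnC.
- case=> -[|t] [i [lei ec ep]].
    set i' := (i + Posz d - 1)%R.
    have ei : proj3 d p.2 = tab_row0 i' by rewrite ep proj_tab_row3.
    have [[k ek]|neg] : (exists k, i' = Posz k) \/ (i' < 0)%R.
      by clearbody i'; case: i' ei => k _; [left; exists k|right].
    + case: (ltnP k n) => [ltk|lek].
        have cE : c = k + 4 * e + 2 * (Q * e) + (5 - d).
          by move: ec; rewrite /place /i' in ek *; lia.
        exists (Some (SF (Some (nth false w k)))), (5 - d), (k + 4 * e + 2 * (Q * e)).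
        split => //; last by exists k.
        by apply: RunClaim; rewrite ei ek tab_row0_pos.
      have cE : c = k + 4 * e + 2 * (Q * e) + (5 - d).
        by move: ec; rewrite /place /i' in ek *; lia.
      exists (Some (SF None)), (5 - d), (k + 4 * e + 2 * (Q * e)).
      split => //; first by apply: RunClaim; rewrite ei ek tab_row0_ge.
      exists (k - n + 2 * e + 2 * (Q * e)); first by lia.
      (* The term [2 * (Q * e)] of [place] reserves exactly [2 * e] rounds for a range test; the
         shift by [2 * e] sends the cells from [n] to [n + 2 * e] onto the window from [2 * e] to
         [4 * e]. *)
      exists (2 * e), (k - n + 2 * e); split; last by lia.
      by rewrite /i' in ek; lia.
    + case: (ltrP i' (-1)%R) => lt1.
        exists (Some (SA false)), (3 - d), (absz (i' + Posz (4 * e + 2))%R + 2 * (Q * e)); split.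
        * by apply: RunLeft; rewrite ei tab_row0_lt.
        * by move: ec; rewrite /place /i' in lt1 neg *; lia.
        * exists (2 * e), (absz (i' + Posz (4 * e + 2))%R); split; last by lia.
          by rewrite /i' in lt1 *; lia.
      have i1 : i' = (-1)%R by lia.
      exists None, (4 - d + 4 * e + 2 * (Q * e)), 0; split => //.
        by apply: RunStart; rewrite ei i1.
      by move: ec; rewrite /place /i' in i1 *; lia.
  set i' := (i + Posz d - 1)%R.
  have [c' ec'] : exists c' : nat, Posz c' = place t i'.
    by exists (absz (place t i')); rewrite /place /i'; lia.
  exists (Some (ST (~~ p.1, tab_row3 t i'))), (3 - d + T), c'; split.
  - by apply: RunStep; rewrite rule_tab_row3 ep proj_tab_row3.
  - by move: ec ec'; rewrite /place /i' mulnS; lia.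
  - by exists t, i'; split => //; rewrite /i'; lia.
Qed.

Lemma good_check k s c : good s c -> exists t h c',
  [/\ check_move k s t h, c = c' + h & if t is Some s' then good s' c' else c' = 0].
Proof.
case: s => [j|a|x|p] gd.
- case: c {gd} => [|c]; first by exists None, 0, 0; split => //; apply: CheckWon.
  by exists (Some (SW j)), 1, c; split; [apply: CheckWalk|rewrite addn1|].
all: by exists (Some (SW k)), 0, c; split => //; [apply: CheckDrop|rewrite addn0].
Qed.

Let menu := tableau_menu g sstart sblk sbit e Q T B w.

Definition Good (y : nat) : Prop :=
  y = 0 \/ exists s c, y = base (Some s) + N * c /\ good s c.

Lemma Good_step y : Good y -> y = 0 \/ forall tau, tau < 5 ->
  exists m, [/\ m \in menu tau, 0 < m <= y & Good (y - m)].
Proof.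
case=> [->|[s [c [-> gd]]]]; [by left|right => tau lt5].
suff [t [h [c' [[mpos mE] min ec gd']]]] : exists t h c',
  [/\ 0 < mag B s t h /\ mag B s t h + base t = base (Some s) + N * h,
      mag B s t h \in menu tau, c = c' + h &
      if t is Some s' then good s' c' else c' = 0].
  have yE : base (Some s) + N * c = mag B s t h + (base t + N * c').
    by rewrite addnA mE ec mulnDr; lia.
  exists (mag B s t h); split => //; first by rewrite mpos yE leq_addr.
  rewrite yE addKn; case: t gd' {yE mpos mE min} => [s'|] gd'; first by right; exists s', c'.
  by left; rewrite gd' muln0.
case: (ltnP tau 3) => [lt3|ge3].
  have [t [h [c' [mv ec gd']]]] := good_run lt3 gd.
  exists t, h, c'; split => //; first exact: run_move_mag mv lt3.
  by apply/mem_run_menu => //; exists s, t, h.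
have [k ->] : exists k : bool, tau = 3 + k by exists (tau == 4); case: eqP; lia.
have [t [h [c' [mv ec gd']]]] := good_check k gd.
exists t, h, c'; split => //; first exact: check_move_mag mv.
by apply/mem_check_menu; exists s, t, h.
Qed.

(** The content is an integer because a move may take more than is left of it while the level keeps
    the counter nonnegative. A negative content is lost at once: run moves never increase it. *)
Definition bad (s : gstate G) (c : int) : Prop :=
  (c < 0)%R \/
  match s with
  | SW _ => False
  | SA _ => ~ awin c
  | SF (Some b) => forall k, k < n -> nth false w k = b -> c <> Posz (k + 4 * e + 2 * (Q * e))
  | SF None => ~ awin (c - Posz (n + 2 * e))%R
  | ST p => exists t i, [/\ t + `|i|%N <= e, c = place t i & p.2 <> tab_row3 t i]
  end.

(** Comparing multiples of [Q] forces [f = rho * t + 2 * e] and then [m = x]. If [t > 0], this gives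
    [x = m >= f >= rho >= 16 * e], against the bound on [x]; so [t = 0], and the bounds on [m]
    become bounds on [x]. *)
Lemma awin_place (x : int) t : `|x|%N < 16 * e -> t <= e ->
  awin (x + Posz (T * t + 2 * (Q * e)))%R ->
  t = 0 /\ (Posz (2 * e) <= x <= Posz (4 * e))%R.
Proof.
move=> ltx let_ [f [m [/andP[le1 le2] E]]].
have {}E : (Posz (m + Q * f) = x + Posz (Q * (rho * t + 2 * e)))%R by move: E; rewrite /T; lia.
have lt : rho * t <= rho * e by rewrite leq_mul2l let_ orbT.
have re : rho <= rho * e by rewrite leq_pmulr.
case: (ltngtP f (rho * t + 2 * e)) => cmp.
- have : Q * f + Q <= Q * (rho * t + 2 * e) by rewrite addnC -mulnS leq_mul2l cmp orbT.
  lia.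
- have : Q * (rho * t + 2 * e) + Q <= Q * f by rewrite addnC -mulnS leq_mul2l cmp orbT.
  lia.
have {}E : Posz m = x by move: E; rewrite cmp; lia.
case: t lt cmp {let_} => [|t]; first by rewrite muln0 => _; lia.
by rewrite mulnS; lia.
Qed.

(** A false triple differs from the true row in some cell, and the opponent asks for that cell. Any
    triple that yields the false value under the rule is itself false; an exit would be correct only
    at row 0 and at a cell that really carries the claimed symbol, so here it leaves a losing
    content. *)
Lemma bad_run s c : level s = 2 -> bad s c -> exists2 d, d < 3 &
  forall t h, run_move g sstart sblk sbit e Q T w d s t h ->
    if t is Some s' then level s' = 2 /\ bad s' (c - Posz h)%R else c <> Posz h.
Proof.
move=> l2 [neg|bd].
  exists 0 => // t h mv.
  by case: mv l2 => // [p q _|p x _|p _|p _|a j jin|a|k ltk|] _; try split => //; try left; lia.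
case: s l2 bd => // [a|[b|]|p] _ bd.
- exists 0 => // t h; move Es: (SA a) => s mv; case: mv Es => // a' => [j jin|] [ea].
    split => //; right => -[f [m [/andP[le1 le2] E]]]; apply: bd.
    exists f.+1, (m + j); split; last by rewrite mulnS; lia.
    by move: jin; rewrite !inE => /orP[]/eqP->; lia.
  by move=> c0; apply: bd; exists 0, 0; split => //; lia.
- exists 0 => // t h; move Es: (SF (Some b)) => s mv; case: mv Es => // k ltk [eb].
  exact: bd.
- exists 0 => // t h; move Es: (SF None) => s mv; case: mv Es => // _.
  by split => //; right.
have [t0 [i [lei ec np]]] := bd.
have [d lt3 nd] : exists2 d, d < 3 & proj3 d p.2 <> proj3 d (tab_row3 t0 i).
  case: (p.2) np => [[x1 x2] x3] np.
  case: (classic (x1 = (tab_row3 t0 i).1.1)) => E1; last by exists 0.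
  case: (classic (x2 = (tab_row3 t0 i).1.2)) => E2; last by exists 1.
  case: (classic (x3 = (tab_row3 t0 i).2)) => E3; last by exists 2.
  by case: np; rewrite E1 E2 E3.
exists d => // t h mv.
set i' := (i + Posz d - 1)%R; rewrite proj_tab_row3 // -/i' in nd.
have T_ge : 16 * e <= T.
  have rho_gt0 : 0 < rho by move: rho_ge e_gt0; lia.
  apply: leq_trans rho_ge _; rewrite /T leq_pmulr //.
  by apply: leq_trans Q_ge; rewrite !muln_gt0 rho_gt0 e_gt0.
have QT : 16 * (Q * e) <= T by rewrite mulnCA [T]mulnC leq_mul2l rho_ge orbT.
have eQ : e <= Q * e by rewrite leq_pmull //; apply: leq_trans Q_ge; rewrite !muln_gt0 e_gt0 andbT; move: rho_ge e_gt0; lia.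
have TT : 0 < t0 -> T <= T * t0 by move=> ?; rewrite leq_pmulr.
have t00 : t0 = 0 \/ 0 < t0 by case: (t0); [left|right].
move: mv; move Es: (ST p) => s mv.
case: mv Es => [p' q E|p' x E|p' E|p' E||||||] // [ep]; rewrite -ep {p' ep} in E *.
- split => //; case: t0 lei ec np nd TT t00 {bd} => [|t0] lei ec np nd TT t00.
    (* Descending below row 0 costs [T], which exceeds the whole content. *)
    by left; rewrite ec /place !muln0; lia.
  right; exists t0, i'; split; first by rewrite /i'; lia.
    by rewrite ec /place /i' mulnS; lia.
  by move=> /= Eq; apply: nd; rewrite -E Eq rule_tab_row3.
- split => //; right; case: x E => [b|] E.
    move=> k ltk wk Ec; case: t00 => [t00|tpos]; last first.
      by have := TT tpos; move: Ec; rewrite ec /place /i' in lei * ; lia.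
    apply: nd; rewrite -E t00 /= -wk.
    have -> : i' = Posz k by move: Ec; rewrite ec t00 /place /i'; lia.
    by rewrite tab_row0_pos.
  rewrite ec /place => aw.
  have [|||t00' /andP[le1 le2]] := @awin_place (i' + Posz (2 * t0 + 2 * e) - Posz n)%R t0.
  - by rewrite /i'; lia.
  - by lia.
  - by move: aw; congr awin; rewrite /i'; lia.
  apply: nd; rewrite -E t00' /=.
  have -> : i' = Posz (`|i'|%N) by lia.
  by rewrite tab_row0_ge //; lia.
- split => //; right; rewrite ec /place => aw.
  have [|||t00' /andP[le1 le2]] := @awin_place (i' + Posz (2 * t0 + 4 * e + 2))%R t0.
  - by rewrite /i'; lia.
  - by lia.
  - by move: aw; congr awin; rewrite /i'; lia.
  by apply: nd; rewrite -E t00' /= tab_row0_lt //; lia.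
- move=> Ec; have := TT; case: t00 => [t00|tpos /(_ tpos)].
    move=> _; apply: nd; rewrite -E t00 (_ : i' = -1)%R //.
    by move: Ec; rewrite ec t00 /place /i'; lia.
  by move: Ec; rewrite ec /place; lia.
Qed.

(** * Multiplicities of control states *)

Definition ind (t : option (gstate G)) (j : nat) : int :=
  if t is Some s then Posz (j == rank s) else 0%R.

Lemma sum_ind t : (\sum_(j < nranks G) ind t j * 16 ^+ j)%R = Posz (codeo t).
Proof.
case: t => [s|] /=; last by rewrite big1 // => i _; rewrite mul0r.
rewrite (bigD1 (Ordinal (rank_lt s))) //= eqxx mul1r big1 ?addr0.
  by rewrite /code -natz natrX.
by move=> i /eqP ne; case: eqP => [E|_]; [case: ne; apply: val_inj|rewrite mul0r].
Qed.

Lemma Posz_base t : Posz (base t) = (Posz N * (Posz (levelo t) * Posz B') + Posz (codeo t))%R.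
Proof. by rewrite /base PoszD PoszM /B PoszM -/N mulrCA. Qed.

(* A negative multiplicity of some state other than [SW k] cannot be repaired
   by the check moves with target [SW k]. *)
Definition cheated (k : bool) (lev y : nat) : Prop :=
  exists (v : nat -> int) (z : int) (s : gstate G), [/\ Posz y = (Posz N * z + \sum_(j < nranks G) v j * 16 ^+ j)%R,
    s <> SW k /\ (v (rank s) < 0)%R, forall j, `|v j|%N + lev <= 6 & y < lev * B].

Lemma cheated_neq0 k lev y : cheated k lev y -> y != 0.
Proof.
case=> v [z [s [Ey [_ neg] bnd _]]]; apply/eqP => y0; move: neg.
suff -> : v (rank s) = 0%R by [].
apply: (@base16_eq0 (nranks G)); last exact: rank_lt.
  by move=> j; have := bnd j; lia.
have NE : 16 ^ nranks G = N by rewrite /N /modulus.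
by exists (- z)%R; rewrite NE mulrN; apply/eqP; rewrite -addr_eq0 addrC -Ey y0.
Qed.

(** [B] is a multiple of [N], so level and content only enter the coefficient of [N]; a move takes
    one from the digit of [s] and adds one to that of [t]. *)
Lemma shift_eq y s t h v z : mag B s t h + base t = base (Some s) + N * h -> mag B s t h <= y ->
  Posz y = (Posz N * z + \sum_(j < nranks G) v j * 16 ^+ j)%R ->
  Posz (y - mag B s t h) =
    (Posz N * (z - Posz h - (Posz (level s) - Posz (levelo t)) * Posz B') +
     \sum_(j < nranks G) (v j - ind (Some s) j + ind t j) * 16 ^+ j)%R.
Proof.
move=> mE le Ey; rewrite -subzn // Ey.
have {}mE : (Posz (mag B s t h) = Posz (base (Some s)) + Posz N * Posz h - Posz (base t))%R.
  by move: mE; lia.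
have -> : (\sum_(j < nranks G) (v j - ind (Some s) j + ind t j) * 16 ^+ j =
  \sum_(j < nranks G) v j * 16 ^+ j - Posz (code s) + Posz (codeo t))%R.
  rewrite -[Posz (code s)](sum_ind (Some s)) -sum_ind -sumrB -big_split /=.
  by apply: eq_bigr => j _; rewrite mulrDl mulrBl.
rewrite mE !Posz_base /= -/(levelo _) -/(codeo _); set S := (\sum_(_ < _) _)%R.
move: (Posz N) (Posz (levelo t)) (Posz (level s)) (Posz B') (Posz h) (Posz (code s)) (Posz (codeo t)) S.
by move=> *; ring.
Qed.

(** A check move that changes multiplicities changes each by at most one and lowers the level, hence
    takes at least [B] from [y]. So [lev] drops and pays for the change in [|v j| + lev <= 6]. The
    negative digit survives because only the digit of [SW k] can grow. *)
Lemma cheated_check k lev y (s : gstate G) t h : cheated k lev y -> check_move k s t h ->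
  mag B s t h <= y -> exists lev', cheated k lev' (y - mag B s t h).
Proof.
case=> v [z [s0 [Ey [ne neg] bnd lty]]] mv le.
have [mpos mE] := check_move_mag mv.
have Ey' := shift_eq mE le Ey.
have vneg : (v (rank s0) - ind (Some s) (rank s0) + ind t (rank s0) < 0)%R.
  case: mv {mpos mE Ey' le} => [{}s l2|j|j] /=; try lia.
  by case: (eqVneq (rank s0) k) => [E|_]; [case: ne; apply: rank_inj|lia].
have [et|lvlt] : t = Some s \/ levelo t < level s.
  by case: mv {mpos mE Ey' le vneg} => [{}s l2|j|j]; [right; rewrite l2|left|right].
  exists lev; exists (fun j => v j - ind (Some s) j + ind t j)%R; do 2!eexists; split; first exact: Ey'.
  - by split; first exact: ne.
  - by move=> j; rewrite et; have := bnd j; lia.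
  - by apply: leq_ltn_trans lty; rewrite leq_subr.
have mB : B <= mag B s t h.
  have lB : levelo t * B + B <= level s * B by rewrite addnC -mulSn leq_mul2r lvlt orbT.
  have cle : codeo t <= code s + N * h.
    case: mv {mpos mE Ey' le vneg lvlt lB} => [{}s l2|j|j] //=; last first.
      by rewrite muln1 ltnW // ltn_addl // code_lt.
    (* The winning states have the lowest ranks, hence the smallest codes. *)
    rewrite muln0 addn0 /codeo /= /code leq_exp2l //.
    by case: s l2 => // [a|x|p] _ /=; case: k {bnd lty ne neg Ey}; rewrite ?leq_addr //; lia.
  have {}mE : mag B s t h + (levelo t * B + codeo t) = level s * B + code s + N * h by [].
  lia.
case: lev lty bnd => [|lev] // lty bnd.
exists lev; exists (fun j => v j - ind (Some s) j + ind t j)%R; do 2!eexists; split; first exact: Ey'.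
- by split; first exact: ne.
- move=> j; have := bnd j; rewrite /ind; case: t {mpos mE Ey' le vneg lvlt mB mv} => [t|]; lia.
- by rewrite mulSn in lty; lia.
Qed.

(** The digit of [s] becomes -1: the current state differs from [s], and the target does too because
    run moves never loop. The case [os = None] covers a play that stopped at a nonzero value. *)
Lemma cheated_run d os s t h y (c : int) : d < 3 ->
  Posz y = (Posz (base os) + Posz N * c)%R -> y < 3 * B ->
  run_move g sstart sblk sbit e Q T w d s t h -> os <> Some s -> mag B s t h <= y ->
  exists k, cheated k 3 (y - mag B s t h).
Proof.
move=> lt3 Ey lty mv ne le; have [_ mE] := run_move_mag mv lt3.
have [nt _] := run_move_shape mv lt3.
have {}Ey : Posz y = (Posz N * (c + Posz (levelo os) * Posz B') +
   \sum_(j < nranks G) ind os j * 16 ^+ j)%R.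
  by rewrite Ey Posz_base sum_ind mulrDr; lia.
have indE u : u <> Some s -> ind u (rank s) = 0%R.
  by case: u => //= u nu; case: eqP => // E; case: nu; congr Some; apply: rank_inj.
(* The check menu is chosen so that its winning state is not [s]. *)
exists (if s is SW j then ~~ j else false).
exists (fun j => ind os j - ind (Some s) j + ind t j)%R; eexists; exists s; split.
- exact: (shift_eq mE le Ey).
- split; first by case: (s) => // -[].
  by rewrite (indE os) // (indE t) //= eqxx.
- move=> j; rewrite /ind; case: t {mE le nt mv} => [t|]; case: os {ne Ey} => [u|]; lia.
- by apply: leq_ltn_trans lty; rewrite leq_subr.
Qed.

(** The second case is a stop with content left over: no state remains, so any further run move is a
    cheat. The bound [3 * B] leaves room for two levels and the content, and provides the initial
    [lev = 3] of [cheated]. *)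
Definition Bad (y : nat) : Prop :=
  [\/ exists k lev, cheated k lev y,
      exists c : int, [/\ (0 < c)%R, Posz y = (Posz N * c)%R & y < 3 * B] |
      exists (s : gstate G) (c : int), [/\ level s = 2, Posz y = (Posz (base (Some s)) + Posz N * c)%R,
                      bad s c & y < 3 * B]].

Lemma run_menuP d m : d < 3 -> m \in menu d -> exists (s : gstate G) t h,
  run_move g sstart sblk sbit e Q T w d s t h /\ m = mag B s t h.
Proof. by move=> lt3 mm; apply/mem_run_menu. Qed.

Lemma check_menuP (k : bool) m : m \in menu (3 + k) -> exists (s : gstate G) t h,
  check_move k s t h /\ m = mag B s t h.
Proof. exact: (proj1 (mem_check_menu g sstart sblk sbit e Q T B w k m)). Qed.

Lemma Bad_step y : Bad y -> y != 0 /\ exists tau, tau < 5 /\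
  forall m, m \in menu tau -> m <= y -> Bad (y - m).
Proof.
case=> [[k [lev ch]]|[c [c0 Ey lty]]|[s [c [l2 Ey bd lty]]]].
- split; first exact: cheated_neq0 ch.
  exists (3 + k); split; first by case: (k).
  move=> m /check_menuP[s [t [h [mv ->]]]] le; constructor 1; exists k.
  exact: cheated_check ch mv le.
- split; first by apply/eqP => y0; have := N_gt0; move: Ey; rewrite y0; nia.
  exists 0; split => // m /(run_menuP (isT : 0 < 3))[s [t [h [mv ->]]]] le; constructor 1.
  have Ey0 : (Posz y = Posz (base None) + Posz N * c)%R by rewrite Ey /base add0r.
  have ne0 : None <> Some s by [].
  by have [k ch] := cheated_run (isT : 0 < 3) Ey0 lty mv ne0 le; exists k, 3.
have [d lt3 step] := bad_run l2 bd.
split.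
  (* A zero value would make [code s] a multiple of [N], although [0 < code s < N]. *)
  apply/eqP => y0; move: Ey; rewrite y0 Posz_base => E.
  have {}E : (Posz (code s) = Posz N * (- c - Posz (levelo (Some s)) * Posz B'))%R.
    by move: E; rewrite mulrBr mulrN /=; lia.
  have := code_gt0 s; have := code_lt s; rewrite -/N; move: E; set q := (_ - _)%R.
  have [q0|q1] : (q <= 0)%R \/ (1 <= q)%R by lia.
    by have := ler_wpM2l (_ : (0 <= Posz N)%R) q0; lia.
  by have := ler_wpM2l (_ : (0 <= Posz N)%R) q1; lia.
exists d; split; first by lia.
move=> m /(run_menuP lt3)[s' [t [h [mv ->]]]] le.
case: (classic (s' = s)) => [es|ne]; last first.
  have ne' : Some s <> Some s' by case=> /esym.
  by have [k ch] := cheated_run lt3 Ey lty mv ne' le; constructor 1; exists k, 3.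
subst s'; have [mpos mE] := run_move_mag mv lt3.
have {}Ey : (Posz (y - mag B s t h) = Posz (base t) + Posz N * (c - Posz h))%R.
  by rewrite -subzn // Ey mulrBr; lia.
have lty' : y - mag B s t h < 3 * B by apply: leq_ltn_trans lty; rewrite leq_subr.
have sP := step _ _ mv.
case: t sP Ey lty' {mpos mE le mv} => [s'|] sP Ey' lty'.
  by constructor 3; case: sP => ? ?; exists s', (c - Posz h)%R.
constructor 2; exists (c - Posz h)%R; split => //; last by rewrite Ey' add0r.
have := N_gt0; move: Ey'; rewrite /base /= add0r; nia.
Qed.

Variable sacc : G.

(** The content is [place e 0]: the first claim concerns cells -1, 0 and 1 of row [e]. *)
Definition start_value : nat :=
  base (Some (ST (false, (sacc, sacc, sacc)))) + N * (6 * e + 4 + T * e + 2 * (Q * e)).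

Variable U : seq int.
Hypothesis U_menu : forall u : int, u \in U <->
  exists tau m, [/\ tau < 5, m \in menu tau & u = (- Posz (8 * m + tau))%R].

Let V : seq int := [:: 0; 1; 2; 3; 4]%R.

Lemma tableau_win : tab_row3 e 0 = (sacc, sacc, sacc) -> winning U V (Posz (8 * start_value)).
Proof.
move=> acc; apply: (menu_game_complete U_menu Good_step).
  exists (- Posz (8 * mag (G:=G) B (SW false) None 0 + 0))%R; apply/U_menu.
  exists 0, (mag (G:=G) B (SW false) None 0); split => //.
  by apply/mem_run_menu => //; exists (SW false), None, 0; split => //; apply: RunWon.
right; exists (ST (false, (sacc, sacc, sacc))), (6 * e + 4 + T * e + 2 * (Q * e)); split => //.
by exists e, 0%R; split => //; rewrite ?addn0 // /place; lia.
Qed.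

Lemma tableau_lose : tab_row e 0 <> sacc -> ~ winning U V (Posz (8 * start_value)).
Proof.
move=> nacc; apply: (menu_game_sound U_menu Bad_step).
constructor 3; exists (ST (false, (sacc, sacc, sacc))), (Posz (6 * e + 4 + T * e + 2 * (Q * e))). 
split => //.
  right; exists e, 0%R; split; [by rewrite addn0|by rewrite /place; lia|].
  by rewrite /tab_row3; case=> _ /esym.
rewrite /start_value /base /=; set p := ST _; set c := 6 * e + _ + _ + _.
have cB : c.+1 <= B' by move: B'_ge e_gt0; rewrite /c; lia.
have : N * c.+1 <= B by rewrite leq_mul2l cB orbT.
by have := code_lt p; rewrite mulnS /levelo /codeo /= -/N; lia.
Qed.

End TableauGame.

(** * Tableaux of Turing machines *)

Section Tape.

Definition tape_at (l r : seq nat) (k : int) : nat :=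
  match k with Posz m => nth 0 r m | Negz m => nth 0 l m end.

Lemma tape_at_stay l r s k :
  tape_at l (s :: behead r) k = if k == 0%R then s else tape_at l r k.
Proof. by case: k => [[|k]|k] //=; rewrite nth_behead. Qed.

Lemma tape_at_right l r s k :
  tape_at (s :: l) (behead r) (k - 1)%R = if k == 0%R then s else tape_at l r k.
Proof.
case: k => [[|k]|k] //.
  have -> : (Posz k.+1 - 1 = Posz k)%R by lia.
  by rewrite /= nth_behead.
by have -> : (Negz k - 1 = Negz k.+1)%R by lia.
Qed.

Lemma tape_at_left l r s k :
  tape_at (behead l) (head 0 l :: s :: behead r) (k + 1)%R = if k == 0%R then s else tape_at l r k.
Proof.
case: k => [[|k]|[|k]] //.
  have -> : (Posz k.+1 + 1 = Posz k.+2)%R by lia.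
  by rewrite /= nth_behead.
have -> : (Negz k.+1 + 1 = Negz k)%R by lia.
by rewrite /= nth_behead.
Qed.

End Tape.

Section MachineTableau.

Variable M : TM.
Hypothesis M_wf : tm_wf M.

Let ns := tm_nsyms M.
Let nq := tm_nstates M.

(** [inl] holds the start marker and a permanent accepting symbol. The ordinals have a successor
    size because [inord] requires it; [config_ok] keeps the numbers in range. *)
Definition cell : finType := (bool + 'I_ns.+1 * option 'I_nq.+1)%type.

Definition cstart : cell := inl false.
Definition cacc : cell := inl true.
Definition mk (s : nat) (q : option nat) : cell := inr (inord s, omap inord q).
Definition cbit (b : bool) : cell := mk (sym_of_bit b) None.
Definition cblank : cell := mk 0 None.

Definition accepting (x : cell) : bool :=
  match x with
  | inl b => b
  | inr (_, Some q) => q == 1 :> nat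
  | inr (_, None) => false
  end.

Definition moved (right : bool) (x : cell) : option nat :=
  match x with
  | inr (s, Some q) =>
      if q == 2 :> nat then None else
      let: (q', _, d) := tm_delta M q s in
      match d, right with DRight, true | DLeft, false => Some q' | _, _ => None end
  | _ => None
  end.

(** Acceptance has priority and spreads one cell per row in both directions, so that it can be read
    off at position 0 wherever the head was. The marker puts the initial state on its right
    neighbour and turns blank: row 1 is the initial configuration. A rejecting head stays as it
    is. *)
Definition crule (x y z : cell) : cell :=
  if [|| accepting x, accepting y | accepting z] then cacc
  else if x == cstart then (if y is inr (s, _) then inr (s, Some (inord 0)) else y)
  else if y == cstart then cblank
  else match y with
  | inr (s, Some q) =>
      if q == 2 :> nat then y else
      let: (q', s', d) := tm_delta M q s in
      mk s' (if d is DStay then Some q' else None)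
  | inr (s, None) =>
      match moved true x, moved false z with
      | Some q', _ | None, Some q' => inr (s, Some (inord q'))
      | None, None => y
      end
  | inl _ => y
  end.

Definition config_cell (c : config) (h i : int) : cell :=
  mk (tape_at c.1.2 c.2 (i - h)%R) (if i == h then Some c.1.1 else None).

Definition config_ok (c : config) : Prop :=
  c.1.1 < nq /\ forall k, tape_at c.1.2 c.2 k < ns.

Lemma config_ok_step c : config_ok c -> config_ok (tm_step M c).
Proof.
case: c => [[q l] r] [/= ltq ltt]; rewrite /tm_step.
case: ifP => // _; case: M_wf => _ _ /(_ q (head 0 r) ltq).
have -> : head 0 r = tape_at l r 0 by rewrite /= nth0.
move=> /(_ (ltt 0%R)); case: (tm_delta M q _) => [[q' s'] d] [ltq' lts'].
have upd k : (if k == 0%R then s' else tape_at l r k) < ns by case: ifP.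
case: d.
- have -> : match l with [::] => (q', [::], 0 :: s' :: behead r)
     | a :: l' => (q', l', a :: s' :: behead r) end =
     (q', behead l, head 0 l :: s' :: behead r) by case: (l).
  by split => // k; rewrite /= -[k](subrK 1%R) tape_at_left.
- by split => // k; rewrite /= -[k](addrK 1%R) tape_at_right.
- by split => // k; rewrite /= tape_at_stay.
Qed.

Lemma crule_config c h : config_ok c -> c.1.1 != 1 -> exists h',
  (`|h'|%N <= `|h|%N + 1) /\ forall i, crule (config_cell c h (i - 1)%R) (config_cell c h i)
    (config_cell c h (i + 1)%R) = config_cell (tm_step M c) h' i.
Proof.
case: c => [[q l] r] [ltq ltt] q1; rewrite /= in ltq ltt q1.
have acc0 i : accepting (config_cell (q, l, r) h i) = false.
  rewrite /config_cell /mk /=; case: ifP => //= _.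
  by rewrite inordK ?(negbTE q1) //; apply: ltnW.
have st0 i : (config_cell (q, l, r) h i == cstart) = false by [].
have symE k : inord (n' := ns) (tape_at l r k) = tape_at l r k :> nat by rewrite inordK // ltnS ltnW.
have qE : inord (n' := nq) q = q :> nat by rewrite inordK // ltnS ltnW.
have movedE b i : moved b (config_cell (q, l, r) h i) =
    if i == h then (if q == 2 then None else let: (q', _, d) := tm_delta M q (head 0 r) in
      match d, b with DRight, true | DLeft, false => Some q' | _, _ => None end) else None.
  rewrite /config_cell /mk /=; case: eqP => //= ->.
  by rewrite qE symE subrr /= nth0.
have ruleE i : crule (config_cell (q, l, r) h (i - 1)%R) (config_cell (q, l, r) h i)
    (config_cell (q, l, r) h (i + 1)%R) =
    if i == h then
      if q == 2 then config_cell (q, l, r) h i else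
      let: (q', s', d) := tm_delta M q (head 0 r) in mk s' (if d is DStay then Some q' else None)
    else match moved true (config_cell (q, l, r) h (i - 1)%R),
               moved false (config_cell (q, l, r) h (i + 1)%R) with
      | Some q', _ | None, Some q' => mk (tape_at l r (i - h)%R) (Some q')
      | None, None => config_cell (q, l, r) h i
      end.
  case: (eqVneq i h) => [->|ne].
    rewrite /crule !acc0 !st0 /=.
    by rewrite /config_cell /mk eqxx /= qE symE subrr /= nth0.
  have -> : config_cell (q, l, r) h i = inr (inord (tape_at l r (i - h)%R), None).
    by rewrite /config_cell (negbTE ne).
  have gen x z s : accepting x = false -> accepting z = false -> (x == cstart) = false ->
    crule x (inr (s, None)) z = match moved true x, moved false z with
      | Some q', _ | None, Some q' => inr (s, Some (inord q'))
      | None, None => inr (s, None) end.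
    by rewrite /crule => -> -> ->.
  by rewrite gen.
have [q2|q2] := eqVneq q 2.
  exists h; split; first by lia.
  move=> i; rewrite ruleE !movedE q2 /tm_step /=.
  by case: ifP => // _; case: ifP; case: ifP.
have step : tm_step M (q, l, r) =
  let: (q', s', d) := tm_delta M q (head 0 r) in
  match d with
  | DStay => (q', l, s' :: behead r)
  | DRight => (q', s' :: l, behead r)
  | DLeft => (q', behead l, head 0 l :: s' :: behead r)
  end.
  rewrite /tm_step (negbTE q1) (negbTE q2) /=; case: tm_delta => [[q' s'] []] //.
  by case: (l).
rewrite (negbTE q2) in ruleE movedE.
rewrite step {step}; case E : (tm_delta M q (head 0 r)) ruleE movedE => [[q' s'] d] ruleE movedE.
exists (match d with DStay => h | DRight => h + 1 | DLeft => h - 1 end)%R.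
split; first by case: (d); lia.
move=> i; rewrite ruleE !movedE.
have e0 : (i - h == 0)%R = (i == h) by rewrite subr_eq0.
case: d {E ruleE movedE}; rewrite /config_cell /=.
- rewrite (_ : i - (h - 1) = (i - h) + 1)%R; last by lia.
  rewrite tape_at_left e0; case: (eqVneq i h) => [->|ne].
    by rewrite (_ : (h == h - 1)%R = false) //; lia.
  have -> : (i == h - 1)%R = (i + 1 == h)%R by lia.
  by case: (i - 1 == h)%R; case: ifP.
- rewrite (_ : i - (h + 1) = (i - h) - 1)%R; last by lia.
  rewrite tape_at_right e0; case: (eqVneq i h) => [->|ne].
    by rewrite (_ : (h == h + 1)%R = false) //; lia.
  have -> : (i == h + 1)%R = (i - 1 == h)%R by lia.
  by case: (i - 1 == h)%R => //; case: ifP.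
- rewrite tape_at_stay e0; case: (eqVneq i h) => [_|ne] //.
  by case: ifP; case: ifP.
Qed.

Section Acceptance.

Variables (w : seq bool) (T0 e : nat).
Hypothesis e_ge : 2 * T0 + 2 <= e.

Let R := tab_row crule cstart cblank cbit w.

Lemma config_ok_run s : config_ok (tm_run M w s).
Proof.
elim: s => [|s IH]; last by rewrite /tm_run iterS; apply: config_ok_step.
case: M_wf => nq3 ns3 _; split; first by rewrite /=; apply: leq_trans nq3.
have lt0 : 0 < ns by apply: leq_trans ns3.
case=> k /=; last by rewrite nth_nil.
case: (ltnP k (size (map sym_of_bit w))) => [lt|ge]; last by rewrite nth_default.
rewrite size_map in lt; rewrite (nth_map false) //; apply: leq_trans ns3.
by case: nth.
Qed.

Lemma tab_row0E j : tab_row0 cstart cblank cbit w j =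
  if j == (-1)%R then cstart else mk (tape_at [::] (map sym_of_bit w) j) None.
Proof.
case: j => [k|[|k]] //=.
case: (ltnP k (size w)) => [lt|ge]; last by rewrite !nth_default ?size_map.
by rewrite !(nth_map false).
Qed.

Lemma tab_row1 i : R 1 i = config_cell (tm_init w) 0 i.
Proof.
rewrite /R /= !tab_row0E /config_cell /= subr0.
have acc0 j : accepting (if j == (-1)%R then cstart else mk (tape_at [::] (map sym_of_bit w) j) None) = false.
  by case: ifP.
have moved0 b j : moved b (if j == (-1)%R then cstart else mk (tape_at [::] (map sym_of_bit w) j) None) = None.
  by case: ifP.
rewrite /crule !acc0 !moved0 /=.
have -> : (i - 1 == -1)%R = (i == 0)%R by lia.
case: (eqVneq i 0%R) => [->|ne] //=.
by case: (eqVneq i (-1)%R) => [->|].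
Qed.

Lemma tab_rowS t i : R t.+1 i = crule (R t (i - 1)%R) (R t i) (R t (i + 1)%R).
Proof. by []. Qed.

Lemma tab_row_config s : (forall s', s' < s -> cfg_state (tm_run M w s') != 1) ->
  exists2 h, `|h|%N <= s & forall i, R s.+1 i = config_cell (tm_run M w s) h i.
Proof.
elim: s => [|s IH] run; first by exists 0%R => // i; rewrite tab_row1.
have [s' lts|h leh rowE] := IH; first by apply: run; apply: leq_trans lts _.
have [h' [leh' stepE]] := crule_config h (config_ok_run s) (run s (leqnn _)).
exists h'; first by lia.
by move=> i; rewrite tab_rowS !rowE stepE.
Qed.

Lemma state_halted s s' q : (q == 1) || (q == 2) -> s <= s' ->
  cfg_state (tm_run M w s) = q -> cfg_state (tm_run M w s') = q.
Proof.
move=> q12 /subnK <-; elim: (s' - s) => [|d IH] // /IH {IH}.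
rewrite addSn /tm_run iterS -/(tm_run M w (d + s)).
by case: (tm_run M w (d + s)) => [[q' l] r]; rewrite /tm_step /cfg_state /= => ->; rewrite q12.
Qed.

Lemma accepting_spread t i r j : accepting (R t i) -> `|j - i|%N <= r.+1 ->
  R (t + r.+1) j = cacc.
Proof.
move=> acc; elim: r j => [|r IH] j le.
  rewrite addn1 tab_rowS /crule.
  have [<-|[<-|<-]] : i = (j - 1)%R \/ i = j \/ i = (j + 1)%R by lia.
  - by rewrite acc.
  - by rewrite acc orbT.
  - by rewrite acc !orbT.
rewrite addnS tab_rowS /crule.
have [le'|[le'|le']] : `|(j - 1 - i)%R|%N <= r.+1 \/ `|(j - i)%R|%N <= r.+1 \/ `|(j + 1 - i)%R|%N <= r.+1 by lia.
- by rewrite (IH _ le').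
- by rewrite (IH _ le') orbT.
- by rewrite (IH _ le') !orbT.
Qed.

(** Acceptance at time [s <= T0] shows in row [s.+1] at distance at most [s] from 0, and [s.+1]
    further rows cover the cells -1, 0 and 1; hence [2 * T0 + 2 <= e]. The first such time is taken
    because rows are configurations only up to then. *)
Lemma tab_row_accept : cfg_state (tm_run M w T0) = 1 ->
  tab_row3 crule cstart cblank cbit w e 0 = (cacc, cacc, cacc).
Proof.
move=> acc.
have ex : exists s, cfg_state (tm_run M w s) == 1 by exists T0; apply/eqP.
case: (ex_minnP ex) => s /eqP accs min.
have les : s <= T0 by apply: min; apply/eqP.
have [s' lts|h leh rowE] := @tab_row_config s.
  by apply/negP => /min; rewrite leqNgt lts.
have acch : accepting (R s.+1 h).
  rewrite rowE /config_cell eqxx /mk /= /cfg_state in accs *.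
  by rewrite accs inordK //; case: M_wf; rewrite -/nq; lia.
have eE : e = s.+1 + (e - s.+2).+1 by lia.
by rewrite /tab_row3 -/R eE; congr (_, _, _); apply: (accepting_spread acch); lia.
Qed.

Lemma tab_row_reject : cfg_state (tm_run M w T0) = 2 -> tab_row crule cstart cblank cbit w e 0 <> cacc.
Proof.
move=> rej; rewrite -/R.
have [s' lts|h leh rowE] := @tab_row_config e.-1.
  apply/eqP => acc; case: (leqP s' T0) => le.
    by have := state_halted (isT : (1 == 1) || (1 == 2)) le acc; rewrite rej.
  by have := state_halted (isT : (2 == 1) || (2 == 2)) (ltnW le) rej; rewrite acc.
have eE : e = e.-1.+1 by lia.
by rewrite eE rowE.
Qed.

End Acceptance.

End MachineTableau.

(** * Typed Turing machines *)

Section Numbering.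

Variables (X : finType) (x0 : X) (xs : seq X).

(** The listed elements come first so that the three special states, and the blank with the two
    bits, receive the numbers 0, 1 and 2 fixed by the machine model. *)
Definition numbering : seq X := (x0 :: xs) ++ [seq x <- enum X | x \notin x0 :: xs].

Definition encode (x : X) : nat := index x numbering.
Definition decode (m : nat) : X := nth x0 numbering m.

Lemma mem_numbering x : x \in numbering.
Proof. by rewrite mem_cat mem_filter mem_enum andbT orbN. Qed.

Lemma encodeK : cancel encode decode.
Proof. by move=> x; rewrite /decode nth_index // mem_numbering. Qed.

Lemma encode_lt x : encode x < size numbering.
Proof. by rewrite index_mem mem_numbering. Qed.

Lemma encode_x0 : encode x0 = 0.
Proof. by rewrite /encode /= eqxx. Qed.

Lemma encode_eq x y : (encode x == encode y) = (x == y).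
Proof. by apply: (inj_eq (can_inj encodeK)). Qed.

End Numbering.

Section TypedMachine.

Variables (Q A : finType).
Variables (qstart qacc qrej : Q) (blank off on : A).
Variable delta : Q -> A -> Q * A * dir.
Hypothesis Q_uniq : uniq [:: qstart; qacc; qrej].
Hypothesis A_uniq : uniq [:: blank; off; on].

Let eQ := encode qstart [:: qacc; qrej].
Let dQ := decode qstart [:: qacc; qrej].
Let eA := encode blank [:: off; on].
Let dA := decode blank [:: off; on].

Definition typed_tm : TM := {|
  tm_nstates := size (numbering qstart [:: qacc; qrej]);
  tm_nsyms := size (numbering blank [:: off; on]);
  tm_delta := fun q s => let: (q', s', d) := delta (dQ q) (dA s) in (eQ q', eA s', d) |}.

Lemma typed_tm_wf : tm_wf typed_tm.
Proof.
split; rewrite ?size_cat // => q s _ _ /=.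
by case: delta => [[q' s'] d]; split; apply: encode_lt.
Qed.

Definition tconfig := (Q * seq A * seq A)%type.

Definition tstep (c : tconfig) : tconfig :=
  let: (q, l, r) := c in
  if (q == qacc) || (q == qrej) then c else
  let: (q', s', d) := delta q (head blank r) in
  match d with
  | DStay => (q', l, s' :: behead r)
  | DRight => (q', s' :: l, behead r)
  | DLeft => (q', behead l, head blank l :: s' :: behead r)
  end.

Definition embed (c : tconfig) : config := (eQ c.1.1, map eA c.1.2, map eA c.2).

Lemma eQ_acc : eQ qacc = 1.
Proof.
move: Q_uniq; rewrite /eQ /encode /= !inE eqxx => /andP[/norP[ne _] _].
by rewrite (negbTE ne).
Qed.

Lemma eQ_rej : eQ qrej = 2.
Proof.
move: Q_uniq; rewrite /eQ /encode /= !inE eqxx => /andP[/norP[_ ne] /andP[ne' _]].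
by rewrite (negbTE ne) (negbTE ne').
Qed.

Lemma eA_off : eA off = 1.
Proof.
move: A_uniq; rewrite /eA /encode /= !inE eqxx => /andP[/norP[ne _] _].
by rewrite (negbTE ne).
Qed.

Lemma eA_on : eA on = 2.
Proof.
move: A_uniq; rewrite /eA /encode /= !inE eqxx => /andP[/norP[_ ne] /andP[ne' _]].
by rewrite (negbTE ne) (negbTE ne').
Qed.

Lemma tm_step_embed c : tm_step typed_tm (embed c) = embed (tstep c).
Proof.
case: c => [[q l] r]; rewrite /tm_step /embed /tstep /=.
rewrite -{1}eQ_acc -{1}eQ_rej !encode_eq; case: ifP => // _.
have -> : head 0 (map eA r) = eA (head blank r) by case: r => //=; rewrite /eA encode_x0.
rewrite /dQ /eQ encodeK -/eQ /dA encodeK.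
case: delta => [[q' s'] []] /=; rewrite ?behead_map //.
by case: l => //=; rewrite /eA encode_x0.
Qed.

Definition raw (b : bool) : A := if b then on else off.

Lemma tm_init_embed w : tm_init w = embed (qstart, [::], map raw w).
Proof.
rewrite /tm_init /embed /= -map_comp; congr (_, _, _); first by rewrite /eQ encode_x0.
by apply: eq_map => -[]; rewrite /= ?eA_on ?eA_off.
Qed.

Lemma tm_run_embed w t : tm_run typed_tm w t = embed (iter t tstep (qstart, [::], map raw w)).
Proof.
elim: t => [|t IH]; first exact: tm_init_embed.
by rewrite iterS -tm_step_embed -IH.
Qed.

Lemma cfg_output_embed q l out : cfg_output (embed (q, l, map raw out)) = out.
Proof.
have rawE b : eA (raw b) = sym_of_bit b by case: b; rewrite /= ?eA_on ?eA_off.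
have -> : embed (q, l, map raw out) = (eQ q, map eA l, map sym_of_bit out).
  by rewrite /embed /= -map_comp; congr (_, _, _); apply: eq_map => b /=.
rewrite /cfg_output /= -[in RHS](take_size out).
have -> : find (fun s => (s != 1) && (s != 2)) (map sym_of_bit out) = size out.
  by elim: out => //= b out ->; case: b.
rewrite -map_take take_size -map_comp -[RHS]map_id; apply: eq_map.
by case.
Qed.

Lemma tstep_halted l r t : iter t tstep (qacc, l, r) = (qacc, l, r).
Proof. by elim: t => // t IH; rewrite iterS IH /= eqxx. Qed.

Lemma typed_computes (f : seq bool -> seq bool) (T : nat -> nat) :
  (forall w, exists t l, t <= T (size w) /\
     iter t tstep (qstart, [::], map raw w) = (qacc, l, map raw (f w))) ->
  computes_in typed_tm f T.
Proof.
move=> H w; have [t [l [le E]]] := H w.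
rewrite /= tm_run_embed -(subnK le) iterD E tstep_halted.
by split; [apply: eQ_acc|apply: cfg_output_embed].
Qed.

End TypedMachine.

(** * A machine executing loop programs *)

(* A loop language whose memory is the input word, one binary counter with as
   many bits as the input, and markers on input positions. *)
Inductive prog :=
  | PEmit of bool
  | PSkip
  | PSeq of prog & prog
  | PFor of nat & prog
  | PIn of nat & prog & prog
  | PCt of nat & prog & prog
  | PInc.

(** Jump targets are absolute. [IIn] and [ICt] jump if the tested bit is false, [IFirst] if the
    input is empty, [INext] back to the loop body while a next cell exists. *)
Inductive instr :=
  | IEmit of bool
  | IFirst of nat & nat
  | INext of nat & nat
  | IIn of nat & nat
  | ICt of nat & nat
  | IInc
  | IJmp of nat.

Fixpoint csize (p : prog) : nat :=
  match p with
  | PEmit _ | PInc => 1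
  | PSkip => 0
  | PSeq p q => csize p + csize q
  | PFor _ p => (csize p).+2
  | PIn _ p q | PCt _ p q => (csize p + csize q).+2
  end.

Fixpoint compile (base : nat) (p : prog) : seq instr :=
  match p with
  | PEmit b => [:: IEmit b]
  | PInc => [:: IInc]
  | PSkip => [::]
  | PSeq p q => compile base p ++ compile (base + csize p) q
  | PFor r p => IFirst r (base + (csize p).+2) :: compile base.+1 p ++ [:: INext r base.+1]
  | PIn r p q => IIn r (base + (csize p).+2) :: compile base.+1 p ++
      IJmp (base + (csize p + csize q).+2) :: compile (base + (csize p).+2) q
  | PCt r p q => ICt r (base + (csize p).+2) :: compile base.+1 p ++
      IJmp (base + (csize p + csize q).+2) :: compile (base + (csize p).+2) q
  end.

Lemma size_compile base p : size (compile base p) = csize p.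
Proof.
elim: p base => //= [p IHp q IHq|r p IHp|r p IHp q IHq|r p IHp q IHq] base;
  by rewrite ?size_cat /= ?IHp ?IHq ?addnS ?addn0.
Qed.

Section Machine.

Variable K : nat.

Definition letter : finType := (bool * bool * {ffun 'I_K.+1 -> bool})%type.

Definition mark (r : nat) (a : letter) : bool := a.2 (inord r).
Definition set_mark (r : nat) (b : bool) (a : letter) : letter :=
  (a.1, [ffun i : 'I_K.+1 => if i == r :> nat then b else a.2 i]).

(** [ms] is the finite state carried along a sweep. For [INext], [Some false] means that the marker
    was lifted from the previous cell and [Some true] that it has been put down again; for [IInc],
    [None] is a pending carry, the counter being stored least significant bit first. *)
Definition cellop (i : instr) (ms : option bool) (a : letter) : option bool * letter :=
  match i with
  | IFirst r _ => if ms is None then (Some false, set_mark r true a) else (ms, a)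
  | INext r _ =>
      match ms with
      | None => if mark r a then (Some false, set_mark r false a) else (None, a)
      | Some false => (Some true, set_mark r true a)
      | Some true => (ms, a)
      end
  | IIn r _ => (if mark r a && a.1.1 then Some false else ms, a)
  | ICt r _ => (if mark r a && a.1.2 then Some false else ms, a)
  | IInc => if ms is None
            then (if a.1.2 then None else Some false, (a.1.1, ~~ a.1.2, a.2)) else (ms, a)
  | IEmit _ | IJmp _ => (ms, a)
  end.

Definition endop (i : instr) (pc : nat) (ms : option bool) : nat * option bool :=
  match i with
  | IEmit b => (pc.+1, Some b)
  | IFirst _ L => (if ms is None then L else pc.+1, None)
  | INext _ L => (if ms is Some true then L else pc.+1, None)
  | IIn _ L | ICt _ L => (if ms is None then L else pc.+1, None)
  | IInc => (pc.+1, None)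
  | IJmp L => (L, None)
  end.

Fixpoint sweep (i : instr) (ms : option bool) (s : seq letter) : option bool * seq letter :=
  if s is a :: s' then
    let: (ms1, a1) := cellop i ms a in
    let: (ms2, s2) := sweep i ms1 s' in (ms2, a1 :: s2)
  else (ms, [::]).

Lemma sweep_iota i (m : nat -> option bool) f f' a l :
  (forall j, a <= j < a + l -> cellop i (m j) (f j) = (m j.+1, f' j)) ->
  sweep i (m a) (map f (iota a l)) = (m (a + l), map f' (iota a l)).
Proof.
elim: l a => [|l IH] a H /=; first by rewrite addn0.
rewrite H; last by lia.
by rewrite IH => [|j le]; [rewrite addSnnS|apply: H; lia].
Qed.

Variable code : seq instr.

Definition mconfig := (nat * seq letter * seq bool)%type.

Definition instr_at (pc : nat) : instr := nth (IJmp (size code)) code pc.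

Definition mstep (c : mconfig) : mconfig :=
  let: (pc, s, out) := c in
  let: (ms, s') := sweep (instr_at pc) None s in
  let: (pc', o) := endop (instr_at pc) pc ms in
  (pc', s', if o is Some b then rcons out b else out).

Section Semantics.

Variable w : seq bool.
Let n := size w.

Definition env := nat -> option nat.
Definition upd (rho : env) (r : nat) (v : option nat) : env := fun x => if x == r then v else rho x.

Definition marks (rho : env) (j : nat) : {ffun 'I_K.+1 -> bool} := [ffun i : 'I_K.+1 => rho i == Some j].

Definition cell_at (rho : env) (c j : nat) : letter := (nth false w j, odd (c %/ 2 ^ j), marks rho j).

Definition cells (rho : env) (c : nat) : seq letter := map (cell_at rho c) (iota 0 n).

Lemma eq_cells rho rho' c : rho =1 rho' -> cells rho c = cells rho' c.
Proof.
move=> E; apply: eq_map => j; congr (_, _).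
by apply/ffunP => i; rewrite !ffunE E.
Qed.

Lemma mark_cell rho c j r : r <= K -> mark r (cell_at rho c j) = (rho r == Some j).
Proof. by move=> le; rewrite /mark ffunE inordK. Qed.

Lemma set_mark_cell rho v c j r :
  set_mark r (v == Some j) (cell_at rho c j) = cell_at (upd rho r v) c j.
Proof. by congr (_, _); apply/ffunP => i; rewrite !ffunE /upd; case: eqP. Qed.

Lemma upd_cell rho v c j r : (rho r == Some j) = (v == Some j) ->
  cell_at (upd rho r v) c j = cell_at rho c j.
Proof.
by move=> E; congr (_, _); apply/ffunP => i; rewrite !ffunE /upd; case: (eqVneq (i : nat) r) => // ->.
Qed.

Lemma sweep_cells i (m : nat -> option bool) rho c rho' c' :
  m 0 = None -> (forall j, j < n -> cellop i (m j) (cell_at rho c j) = (m j.+1, cell_at rho' c' j)) ->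
  sweep i None (cells rho c) = (m n, cells rho' c').
Proof. by move=> <- H; apply: (@sweep_iota _ m _ _ 0) => j; rewrite add0n; apply: H. Qed.

Lemma mstep_emit pc rho c out b : instr_at pc = IEmit b ->
  mstep (pc, cells rho c, out) = (pc.+1, cells rho c, rcons out b).
Proof. by move=> E; rewrite /mstep E (@sweep_cells _ (fun=> None) _ _ rho c). Qed.

Lemma mstep_jmp pc rho c out L : instr_at pc = IJmp L ->
  mstep (pc, cells rho c, out) = (L, cells rho c, out).
Proof. by move=> E; rewrite /mstep E (@sweep_cells _ (fun=> None) _ _ rho c). Qed.

Lemma mstep_first pc rho c out r L : instr_at pc = IFirst r L -> rho r = None ->
  mstep (pc, cells rho c, out) =
    if n == 0 then (L, cells rho c, out) else (pc.+1, cells (upd rho r (Some 0)) c, out).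
Proof.
move=> E rN; rewrite /mstep E.
rewrite (@sweep_cells _ (fun j => if j == 0 then None else Some false) _ _ (upd rho r (Some 0)) c) //.
  by case: eqP => // n0; rewrite /cells -/n n0.
move=> [|j] lt /=; first by rewrite -set_mark_cell.
by rewrite upd_cell // rN.
Qed.

Lemma mstep_next pc rho c out r L p : instr_at pc = INext r L -> r <= K -> rho r = Some p -> p < n ->
  mstep (pc, cells rho c, out) =
    if p.+1 < n then (L, cells (upd rho r (Some p.+1)) c, out)
    else (pc.+1, cells (upd rho r None) c, out).
Proof.
move=> E ler rp lt; rewrite /mstep E.
set v := if p.+1 < n then Some p.+1 else None.
rewrite (@sweep_cells _ (fun j => if j <= p then None else Some (j != p.+1)) _ _ (upd rho r v) c) //.
  rewrite leqNgt lt /= /v; case: ltnP => le; first by rewrite (_ : n != p.+1) //; lia.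
  by rewrite (_ : n == p.+1) //; lia.
have SE a b : (Some a == Some b) = (a == b :> nat) by [].
have NE b : (None == Some b :> option nat) = false by [].
move=> j ltj; rewrite /cellop mark_cell // rp.
case: (ltngtP j p) => cmp.
- rewrite SE (_ : (p == j) = false); last by lia.
  by rewrite upd_cell // rp /v; case: ifP => _; rewrite ?SE ?NE; lia.
- rewrite /=.
  case: (eqVneq j p.+1) => [->|ne] /=.
    rewrite (_ : p.+2 != p.+1); last by lia.
    by rewrite -set_mark_cell /v (_ : p.+1 < n) ?eqxx //; lia.
  rewrite (_ : j.+1 != p.+1) ; last by lia.
  by rewrite upd_cell // rp /v; case: ifP => _; rewrite ?SE ?NE; lia.
- rewrite cmp SE eqxx -set_mark_cell /v.
  rewrite eqxx /=.
  by congr (_, set_mark _ _ _); case: ifP => _; rewrite ?SE ?NE; lia.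
Qed.

Lemma mstep_in pc rho c out r L p : instr_at pc = IIn r L -> r <= K -> rho r = Some p -> p < n ->
  mstep (pc, cells rho c, out) = (if nth false w p then pc.+1 else L, cells rho c, out).
Proof.
move=> E ler rp lt; rewrite /mstep E.
rewrite (@sweep_cells _ (fun j => if (p < j) && nth false w p then Some false else None) _ _ rho c) //.
  by rewrite lt /=; case: nth.
move=> j ltj; rewrite /cellop mark_cell // rp /= ltnS.
case: (eqVneq p j) => [->|ne]; first by rewrite eqxx leqnn ltnn /=; case: nth.
have -> : (Some p == Some j) = false by apply/eqP => -[]; apply/eqP.
by rewrite /= (leq_eqVlt p j) (negbTE ne).
Qed.

Lemma mstep_ct pc rho c out r L p : instr_at pc = ICt r L -> r <= K -> rho r = Some p -> p < n ->
  mstep (pc, cells rho c, out) = (if odd (c %/ 2 ^ p) then pc.+1 else L, cells rho c, out).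
Proof.
move=> E ler rp lt; rewrite /mstep E.
rewrite (@sweep_cells _ (fun j => if (p < j) && odd (c %/ 2 ^ p) then Some false else None) _ _ rho c) //.
  by rewrite lt /=; case: odd.
move=> j ltj; rewrite /cellop mark_cell // rp /= ltnS.
case: (eqVneq p j) => [->|ne]; first by rewrite eqxx leqnn ltnn /=; case: odd.
have -> : (Some p == Some j) = false by apply/eqP => -[]; apply/eqP.
by rewrite /= (leq_eqVlt p j) (negbTE ne).
Qed.

(** The carry reaches bit [j] exactly when [2 ^ j] divides [c.+1]. *)
Lemma mstep_inc pc rho c out : instr_at pc = IInc ->
  mstep (pc, cells rho c, out) = (pc.+1, cells rho c.+1, out).
Proof.
move=> E; rewrite /mstep E.
rewrite (@sweep_cells _ (fun j => if 2 ^ j %| c.+1 then None else Some false) _ _ rho c.+1) //.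
  by rewrite expn0 dvd1n.
move=> j ltj; rewrite /cellop /cell_at /= divnS ?expn_gt0 // oddD.
case dv : (2 ^ j %| c.+1) => /=.
  have -> : (2 ^ j.+1 %| c.+1) = odd (c %/ 2 ^ j).
    rewrite expnS -[c.+1 in LHS](divnK dv) dvdn_pmul2r ?expn_gt0 //.
    by rewrite divnS ?expn_gt0 // dv dvdn2 oddD /= negbK.
  by case: odd.
have -> : (2 ^ j.+1 %| c.+1) = false.
  by apply/negP => dv'; case/negP: (negbT dv); apply: dvdn_trans dv'; rewrite expnS dvdn_mull.
by [].
Qed.

End Semantics.
End Machine.

Lemma flatten_iotaS (A : Type) (o : nat -> seq A) m :
  flatten (map o (iota 0 m.+1)) = flatten (map o (iota 0 m)) ++ o m.
Proof. by rewrite -addn1 iotaD map_cat flatten_cat /= cats0. Qed.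

Section Execution.

Variables (K : nat) (w : seq bool).
Let n := size w.

(* [exec p rho c out c' st]: with marker positions [rho] and counter value [c],
   [p] prints [out], leaves [c'] in the counter and takes [st] instructions. *)
Inductive exec : prog -> env -> nat -> seq bool -> nat -> nat -> Prop :=
  | EEmit b rho c : exec (PEmit b) rho c [:: b] c 1
  | ESkip rho c : exec PSkip rho c [::] c 0
  | ESeq p q rho c1 c2 c3 o1 o2 s1 s2 : exec p rho c1 o1 c2 s1 -> exec q rho c2 o2 c3 s2 ->
      exec (PSeq p q) rho c1 (o1 ++ o2) c3 (s1 + s2)
  | EFor r p rho (c : nat -> nat) (o : nat -> seq bool) (s : nat -> nat) :
      r <= K -> rho r = None ->
      (forall j, j < n -> exec p (upd rho r (Some j)) (c j) (o j) (c j.+1) (s j)) ->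
      exec (PFor r p) rho (c 0) (flatten (map o (iota 0 n))) (c n) (\sum_(j < n) (s j).+1).+1
  | EIn r p q rho c o c' s j : r <= K -> rho r = Some j -> j < n ->
      exec (if nth false w j then p else q) rho c o c' s ->
      exec (PIn r p q) rho c o c' (s + nth false w j).+1
  | ECt r p q rho c o c' s j : r <= K -> rho r = Some j -> j < n ->
      exec (if odd (c %/ 2 ^ j) then p else q) rho c o c' s ->
      exec (PCt r p q) rho c o c' (s + odd (c %/ 2 ^ j)).+1
  | EInc rho c : exec PInc rho c [::] c.+1 1.

Definition code_at (code : seq instr) (base : nat) (l : seq instr) : Prop :=
  exists pre post, code = pre ++ l ++ post /\ size pre = base.

Lemma code_at_cat code base l1 l2 : code_at code base (l1 ++ l2) ->
  code_at code base l1 /\ code_at code (base + size l1) l2.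
Proof.
case=> pre [post [-> <-]]; split; first by exists pre, (l2 ++ post); rewrite -!catA.
by exists (pre ++ l1), post; rewrite size_cat -!catA.
Qed.

Lemma code_at_cons code base i l : code_at code base (i :: l) ->
  instr_at code base = i /\ code_at code base.+1 l.
Proof.
case=> pre [post [-> <-]]; split.
  by rewrite /instr_at nth_cat ltnn subnn.
by exists (rcons pre i), post; rewrite size_rcons cat_rcons.
Qed.

Definition mrun (code : seq instr) (t : nat) (c : mconfig K) : mconfig K := iter t (mstep code) c.
Arguments mrun : simpl never.
Let st rho c := cells K w rho c.

Lemma run_add code s t c : mrun code (s + t) c = mrun code t (mrun code s c).
Proof. by rewrite /mrun addnC iterD. Qed.

Lemma runS code t c : mrun code t.+1 c = mrun code t (mstep code c).
Proof. exact: iterSr. Qed.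

Lemma run1 code c : mrun code 1 c = mstep code c.
Proof. by []. Qed.

Lemma compile_correct p rho c o c' s : exec p rho c o c' s -> forall code base out,
  code_at code base (compile base p) ->
  mrun code s (base, st rho c, out) = (base + csize p, st rho c', out ++ o).
Proof.
elim=> {p rho c o c' s}.
- move=> b rho c code base out /code_at_cons[E _]; rewrite run1 (mstep_emit _ _ _ _ _ E).
  by rewrite addn1 cats1.
- by move=> rho c code base out _; rewrite /mrun /= addn0 cats0.
- move=> p q rho c1 c2 c3 o1 o2 s1 s2 _ IHp _ IHq code base out /code_at_cat[Cp Cq].
  rewrite size_compile in Cq.
  by rewrite run_add (IHp _ _ _ Cp) (IHq _ _ _ Cq) /= addnA catA.
- move=> r p rho c o s ler rN _ IH code base out /= /code_at_cons[E /code_at_cat[Cp]].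
  rewrite size_compile => /code_at_cons[E' _].
  rewrite runS (mstep_first _ _ _ _ E rN).
  case: (posnP n) => [n0|npos]; first by rewrite n0 big_ord0 /mrun /= cats0.
  (* Loop invariant after [m] iterations. The last iteration is treated apart, since [INext] then
     removes the marker. *)
  have key m : m < n -> mrun code (\sum_(j < m) (s j).+1) (base.+1, st (upd rho r (Some 0)) (c 0), out) =
      (base.+1, st (upd rho r (Some m)) (c m), out ++ flatten (map o (iota 0 m))).
    elim: m => [|m IHm] ltm; first by rewrite big_ord0 /mrun /= cats0.
    rewrite flatten_iotaS catA big_ord_recr /= run_add IHm; last by apply: ltnW.
    rewrite -[(s m).+1]addn1 run_add (IH _ (ltnW ltm) _ _ _ Cp) run1.
    rewrite (mstep_next _ _ E' ler _ (ltnW ltm)); last by rewrite /upd eqxx.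
    rewrite ltm.
    by congr (_, _, _); apply: eq_cells => x; rewrite /upd; case: eqP.
  have [m nE] : exists m, n = m.+1 by exists n.-1; lia.
  have ltm : m < n by rewrite nE.
  rewrite -/st -/n nE flatten_iotaS catA big_ord_recr /= run_add key // -[(s m).+1]addn1 run_add (IH _ ltm _ _ _ Cp) run1.
  rewrite (mstep_next _ _ E' ler _ ltm); last by rewrite /upd eqxx.
  rewrite -/n nE ltnn.
  congr (_, _, _); first by lia.
  by apply: eq_cells => x; rewrite /upd; case: eqP => [->|].
- move=> r p q rho c o c' s j ler rj ltj _ IH code base out /= /code_at_cons[E /code_at_cat[Cp]].
  rewrite size_compile => /code_at_cons[E' Cq].
  rewrite runS (mstep_in _ _ E ler rj ltj).
  case: nth IH => IH.
    rewrite run_add (IH _ _ _ Cp) run1 (mstep_jmp _ _ _ _ _ E').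
    by congr (_, _, _); lia.
  rewrite addn0 (_ : base + (csize p).+2 = (base.+1 + csize p).+1) ?IH //; last by lia.
    by congr (_, _, _); lia.
  by move: Cq; rewrite (_ : base + (csize p).+2 = (base.+1 + csize p).+1) //; lia.
- move=> r p q rho c o c' s j ler rj ltj _ IH code base out /= /code_at_cons[E /code_at_cat[Cp]].
  rewrite size_compile => /code_at_cons[E' Cq].
  rewrite runS (mstep_ct _ _ E ler rj ltj).
  case: (odd _) IH => IH.
    rewrite run_add (IH _ _ _ Cp) run1 (mstep_jmp _ _ _ _ _ E').
    by congr (_, _, _); lia.
  rewrite addn0 (_ : base + (csize p).+2 = (base.+1 + csize p).+1) ?IH //; last by lia.
    by congr (_, _, _); lia.
  by move: Cq; rewrite (_ : base + (csize p).+2 = (base.+1 + csize p).+1) //; lia.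
- move=> rho c code base out /code_at_cons[E _]; rewrite run1 (mstep_inc _ _ _ _ _ E).
  by rewrite addn1 cats0.
Qed.

End Execution.

(** * Simulation by a Turing machine *)

Arguments tstep : simpl never.

Definition label (i : instr) : nat :=
  match i with IFirst _ L | INext _ L | IIn _ L | ICt _ L | IJmp L => L | IEmit _ | IInc => 0 end.

Lemma compile_labels base p : all (fun i => label i <= base + csize p) (compile base p).
Proof.
have weak a b s : all (fun i => label i <= a) s -> a <= b -> all (fun i => label i <= b) s.
  by move=> H le; apply: sub_all H => i /leq_trans; apply.
elim: p base => //= [p IHp q IHq|r p IHp|r p IHp q IHq|r p IHp q IHq] base.
- rewrite all_cat (weak _ _ _ (IHp base)) ?(weak _ _ _ (IHq _)) //; lia.
- rewrite all_cat /= (weak _ _ _ (IHp _)); lia.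
- rewrite all_cat /= (weak _ _ _ (IHp _)) ?(weak _ _ _ (IHq _)) //; lia.
- rewrite all_cat /= (weak _ _ _ (IHp _)) ?(weak _ _ _ (IHq _)) //; lia.
Qed.

Section Simulation.

Variables (K : nat) (code : seq instr).
Let P := size code.
Hypothesis labels_le : all (fun i => label i <= P) code.

Definition sym : finType := (option bool + option (letter K))%type.
Definition Blank : sym := inl None.
Definition Raw (b : bool) : sym := inl (Some b).
Definition End : sym := inr None.
Definition Work (a : letter K) : sym := inr (Some a).

Definition cstate : finType :=
  ('I_3 + 'I_P.+1 * option bool + ('I_P.+1 + 'I_P.+1 * bool))%type.
Definition Special (i : nat) : cstate := inl (inl (inord i)).
Definition Sweep (pc : nat) (ms : option bool) : cstate := inl (inr (inord pc, ms)).
Definition Ret (pc : nat) : cstate := inr (inl (inord pc)).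
Definition Out (pc : nat) (b : bool) : cstate := inr (inr (inord pc, b)).

Definition fresh (b : bool) : letter K := (b, false, [ffun => false]).

(** The tape holds a blank, the work letters, [End], and the bits printed so far. [Out] appends a
    bit at the right end and [Ret] returns to the blank on the left. Halting moves one cell right of
    [End], so the head stands where the model starts reading the output. *)
Definition cdelta (q : cstate) (s : sym) : cstate * sym * dir :=
  match q with
  | inl (inl _) =>
      if s is inl (Some b) then (q, Work (fresh b), DRight) else (Ret 0, End, DLeft)
  | inl (inr (pc, ms)) =>
      match s with
      | inr (Some a) =>
          let: (ms', a') := cellop (instr_at code pc) ms a in (Sweep pc ms', Work a', DRight)
      | inr None =>
          if pc == P :> nat then (Special 1, End, DRight) else
          match endop (instr_at code pc) pc ms with
          | (pc', None) => (Ret pc', End, DLeft)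
          | (pc', Some b) => (Out pc' b, End, DRight)
          end
      | inl _ => (q, s, DStay)
      end
  | inr (inl pc) => if s == Blank then (Sweep pc None, Blank, DRight) else (q, s, DLeft)
  | inr (inr (pc, b)) => if s == Blank then (Ret pc, Raw b, DLeft) else (q, s, DRight)
  end.

Definition printer_tm : TM :=
  typed_tm (Special 0) (Special 1) (Special 2) Blank (Raw false) (Raw true) cdelta.

Let step := tstep (Special 1) (Special 2) Blank cdelta.

Lemma special_eq i j : i < 3 -> j < 3 -> (Special i == Special j) = (i == j).
Proof.
move=> lti ltj; apply/eqP/eqP => [[E]|->] //.
by move: (congr1 (@nat_of_ord 3) E); rewrite !inordK.
Qed.

Lemma sweep_jmp L (s : seq (letter K)) ms : sweep (IJmp L) ms s = (ms, s).
Proof. by elim: s => //= a s ->. Qed.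

Lemma step_init l b r : step (Special 0, l, Raw b :: r) = (Special 0, Work (fresh b) :: l, r).
Proof. by rewrite /step /tstep !special_eq. Qed.

Lemma step_init_end l : step (Special 0, l, [::]) = (Ret 0, behead l, [:: head Blank l; End]).
Proof. by rewrite /step /tstep !special_eq. Qed.

Lemma step_work pc ms l a r : pc <= P -> step (Sweep pc ms, l, Work a :: r) =
  (Sweep pc (cellop (instr_at code pc) ms a).1, Work (cellop (instr_at code pc) ms a).2 :: l, r).
Proof. by move=> le; rewrite /step /tstep /= inordK //; case: cellop. Qed.

Lemma step_halt ms l r : step (Sweep P ms, l, End :: r) = (Special 1, End :: l, r).
Proof. by rewrite /step /tstep /= inordK // eqxx. Qed.

Lemma step_end pc ms l r pc' : pc < P -> endop (instr_at code pc) pc ms = (pc', None) ->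
  step (Sweep pc ms, l, End :: r) = (Ret pc', behead l, head Blank l :: End :: r).
Proof. by move=> lt E; rewrite /step /tstep /= inordK ?(ltn_eqF lt) ?E // ltnW. Qed.

Lemma step_emit pc ms l r pc' b : pc < P -> endop (instr_at code pc) pc ms = (pc', Some b) ->
  step (Sweep pc ms, l, End :: r) = (Out pc' b, End :: l, r).
Proof. by move=> lt E; rewrite /step /tstep /= inordK ?(ltn_eqF lt) ?E // ltnW. Qed.

Lemma step_ret pc l a r : pc <= P -> a != Blank ->
  step (Ret pc, l, a :: r) = (Ret pc, behead l, head Blank l :: a :: r).
Proof. by move=> le /negbTE aB; rewrite /step /tstep /= aB. Qed.

Lemma step_ret_blank pc l r : pc <= P -> step (Ret pc, l, Blank :: r) = (Sweep pc None, Blank :: l, r).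
Proof. by move=> le; rewrite /step /tstep /= inordK. Qed.

Lemma step_out pc b l a r : a != Blank -> step (Out pc b, l, a :: r) = (Out pc b, a :: l, r).
Proof. by move=> /negbTE aB; rewrite /step /tstep /= aB. Qed.

Lemma step_out_end pc b l : pc <= P ->
  step (Out pc b, l, [::]) = (Ret pc, behead l, [:: head Blank l; Raw b]).
Proof. by move=> le; rewrite /step /tstep /= inordK. Qed.

Lemma run_init l w : iter (size w) step (Special 0, l, map Raw w) =
  (Special 0, rev (map Work (map fresh w)) ++ l, [::]).
Proof.
elim: w l => // b w IH l.
by rewrite [size _]/= iterSr /= step_init IH rev_cons cat_rcons.
Qed.

Lemma run_sweep pc ms s l r : pc <= P ->
  iter (size s) step (Sweep pc ms, l, map Work s ++ r) =
  (Sweep pc (sweep (instr_at code pc) ms s).1,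
   rev (map Work (sweep (instr_at code pc) ms s).2) ++ l, r).
Proof.
move=> le; elim: s ms l => // a s IH ms l.
rewrite [size _]/= iterSr /= step_work // IH.
by case: cellop => [ms1 a1] /=; case: sweep => [ms2 s2] /=; rewrite rev_cons cat_rcons.
Qed.

(** The two forms of [t] are needed because the first return meets an unvisited cell, later ones the
    blank already written there. *)
Lemma run_ret pc (x : seq sym) a r t : pc <= P -> Blank \notin a :: x ->
  t = [::] \/ t = [:: Blank] ->
  iter (size x).+2 step (Ret pc, rev x ++ t, a :: r) = (Sweep pc None, [:: Blank], x ++ a :: r).
Proof.
move=> le; elim/last_ind: x a r => [|x y IH] a r.
  rewrite inE eq_sym => ne tE; rewrite iterSr step_ret //.
  have -> : (Ret pc, behead t, [:: head Blank t, a & r]) = (Ret pc, [::], [:: Blank, a & r]).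
    by case: tE => ->.
  by rewrite [iter _ _ _]/= step_ret_blank.
rewrite !inE mem_rcons inE !negb_or => /and3P[na ny nx] tE.
rewrite size_rcons iterSr rev_rcons step_ret; [|exact: le|by rewrite eq_sym].
by rewrite [behead _]/= [head _ _]/= IH ?cat_rcons // inE negb_or ny.
Qed.

Lemma run_out pc b l o : pc <= P ->
  iter (size o) step (Out pc b, l, map Raw o) = (Out pc b, rev (map Raw o) ++ l, [::]).
Proof.
move=> le; elim: o l => // c o IH l.
by rewrite [size _]/= iterSr /= step_out // IH rev_cons cat_rcons.
Qed.

Definition tape (s : seq (letter K)) (o : seq bool) : seq sym := map Work s ++ End :: map Raw o.

Lemma endop_le pc ms : pc < P -> (endop (instr_at code pc) pc ms).1 <= P.
Proof.
move=> lt; have := all_nthP (IJmp P) labels_le pc lt; rewrite -/(instr_at code pc).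
by case: instr_at => //= *; case: ms => [[]|].
Qed.

Lemma notin_work s : Blank \notin map Work s. Proof. by apply/negP => /mapP[]. Qed.
Lemma notin_raw o : Blank \notin map Raw o. Proof. by apply/negP => /mapP[]. Qed.

Lemma size_sweep i ms (s : seq (letter K)) : size (sweep i ms s).2 = size s.
Proof.
elim: s ms => //= a s IH ms; case: cellop => [ms1 a1].
by have := IH ms1; case: sweep => [ms2 s2] /= ->.
Qed.

Lemma run_mstep pc s o : pc < P -> exists t, t <= 2 * (size s + size o) + 6 /\
  iter t step (Sweep pc None, [:: Blank], tape s o) =
  let: (pc', s', o') := mstep code (pc, s, o) in (Sweep pc' None, [:: Blank], tape s' o').
Proof.
move=> lt; have le := ltnW lt; rewrite /mstep.
have := run_sweep None s [:: Blank] (End :: map Raw o) le.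
have := endop_le (sweep (instr_at code pc) None s).1 lt.
have := size_sweep (instr_at code pc) None s.
case: sweep => [ms s'] /= szs; case E : (endop _ pc ms) => [pc' [b|]] /= le' Esw.
- exists ((size s' + size o).+1.+2 + (size o + 1 + size s)); split; first by rewrite szs; set a := size s; set c := size o; clearbody a c; lia.
  rewrite iterD iterD Esw iterD [iter 1 _ _]/= (step_emit _ _ lt E) run_out //.
  (* [run_ret] starts with the head still on the last symbol, whereas here it has already moved
     left; so one step of the return is undone. *)
  rewrite iterSr step_out_end // -(step_ret _ _ le' (isT : Raw b != Blank)) -iterSr.
  have -> : rev (map Raw o) ++ End :: rev (map Work s') ++ [:: Blank] =
      rev (map Work s' ++ End :: map Raw o) ++ [:: Blank].
    by rewrite rev_cat rev_cons cat_rcons -catA.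
  have -> : (size s' + size o).+1 = size (map Work s' ++ End :: map Raw o).
    by rewrite size_cat /= !size_map addnS.
  rewrite run_ret; [|exact: le'| |by right].
    by rewrite /tape map_rcons -cats1 -catA.
  by rewrite !inE mem_cat inE !negb_or notin_work notin_raw.
- exists ((size s').+2 + size s); split; first by rewrite szs; set a := size s; set c := size o; clearbody a c; lia.
  rewrite iterD Esw iterSr (step_end _ _ lt E) -(step_ret _ _ le' (isT : End != Blank)) -iterSr.
  rewrite -(size_map Work) run_ret //; last by right.
  by rewrite inE negb_or notin_work.
Qed.

Lemma mstep_halted (s : seq (letter K)) o : mstep code (P, s, o) = (P, s, o).
Proof.
rewrite /mstep /instr_at nth_default // sweep_jmp /=.
by [].
Qed.

Lemma size_mstep pc (s : seq (letter K)) o : let c := mstep code (pc, s, o) in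
  size c.1.2 = size s /\ size o <= size c.2.
Proof.
rewrite /mstep; have := size_sweep (instr_at code pc) None s.
case: sweep => [ms s'] szs; case: endop => [pc' [b|]]; split => //.
by rewrite size_rcons.
Qed.

Lemma size_mrun m pc (s : seq (letter K)) o : size o <= size (mrun code m (pc, s, o)).2.
Proof.
rewrite /mrun; elim: m => // m IH; apply: leq_trans IH _ => /=.
by case: (iter m _ _) => [[pc' s'] o']; have [] := size_mstep pc' s' o'.
Qed.

Lemma mstep_pc_le pc (s : seq (letter K)) o : pc <= P -> (mstep code (pc, s, o)).1.1 <= P.
Proof.
rewrite leq_eqVlt => /orP[/eqP->|lt]; first by rewrite mstep_halted.
rewrite /mstep; case: sweep => [ms s'].
by have := endop_le ms lt; case: endop => [pc' [b|]].
Qed.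

(** Output only grows, so its final length bounds the cost of every sweep. *)
Lemma run_mrun m pc (s : seq (letter K)) o s' o' : pc <= P -> mrun code m (pc, s, o) = (P, s', o') ->
  exists t l, t <= m * (2 * (size s + size o') + 6) + size s + 1 /\
    iter t step (Sweep pc None, [:: Blank], tape s o) = (Special 1, l, map Raw o').
Proof.
elim: m pc s o => [|m IH] pc s o le.
  move=> [-> -> ->]; exists (1 + size s'); eexists; split; first by lia.
  by rewrite iterD run_sweep // [iter 1 _ _]/= step_halt.
rewrite /mrun iterSr -/(mrun _ _ _).
move: le; rewrite leq_eqVlt => /orP[/eqP->|lt].
  rewrite mstep_halted => /IH[//|t [l [let_ E]]].
  by exists t, l; split => //; lia.
have [t1 [le1 E1]] := run_mstep s o lt.
have := mstep_pc_le s o (ltnW lt); have := size_mstep pc s o.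
case: (mstep code _) E1 => [[pc1 s1] o1] E1 /= [sz1 szo] lepc E.
have [t [l [let_ E2]]] := IH _ _ _ lepc E.
have := size_mrun m pc1 s1 o1; rewrite E /= => szo'.
exists (t + t1), l; split; last by rewrite iterD E1.
move: let_ le1; rewrite sz1 mulSn; set a := size s; set b := size o'; set c := size o.
have cb : c <= b by apply: leq_trans szo szo'.
by clearbody a b c; lia.
Qed.

Lemma printer_run m w s' o' :
  mrun code m (0, cells K w (fun=> None) 0, [::]) = (P, s', o') ->
  exists t l, t <= m * (2 * (size w + size o') + 6) + 4 * size w + 6 /\
    iter t step (Special 0, [::], map Raw w) = (Special 1, l, map Raw o').
Proof.
move=> E; have [t [l [let_ Et]]] := run_mrun (leq0n _) E.
have szc : size (cells K w (fun=> None) 0) = size w by rewrite size_map size_iota.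
exists (t + ((size w).+2 + size w)), l; split; first by move: let_; rewrite szc; lia.
rewrite iterD iterD run_init iterSr step_init_end -(step_ret _ _ (leq0n P) (isT : End != Blank)).
rewrite -iterSr -[in X in X.+2](size_map fresh) -[in X in X.+2](size_map Work) run_ret //; last by left.
  rewrite -[RHS]Et; congr (iter _ _ (_, _, map Work _ ++ _)).
  rewrite /cells -[in LHS](mkseq_nth false w) /mkseq -map_comp; apply: eq_map => j /=.
  by rewrite /fresh /cell_at div0n.
by rewrite inE negb_or notin_work.
Qed.

Lemma printer_tm_wf : tm_wf printer_tm.
Proof. exact: typed_tm_wf. Qed.

Lemma printer_computes (f : seq bool -> seq bool) (m T : nat -> nat) :
  (forall w, exists s', mrun code (m (size w)) (0, cells K w (fun=> None) 0, [::]) = (P, s', f w)) ->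
  (forall w, m (size w) * (2 * (size w + size (f w)) + 6) + 4 * size w + 6 <= T (size w)) ->
  computes_in printer_tm f T.
Proof.
move=> H le; apply: typed_computes => [||w].
- by rewrite /= !inE !special_eq.
- by [].
have [s' E] := H w; have [t [l [let_ Et]]] := printer_run E.
exists t, l; split; first exact: leq_trans let_ (le w).
have rawE v : map (raw (Raw false) (Raw true)) v = map Raw v by apply: eq_map => -[].
by rewrite !rawE.
Qed.

End Simulation.

(** * Running time *)

Definition poly_bounded (g : nat -> nat) := exists a k, forall n, g n <= a * n ^ k + a.

(** The added 1 is for [n = 0] and [k = 0], where the left side is 1. *)
Lemma leq_expD1 n k l : n ^ k <= n ^ (k + l) + 1.
Proof.
case: n => [|n]; first by case: k => [|k]; [exact: leq_addl|rewrite exp0n].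
by apply: leq_trans (leq_addr _ _); rewrite leq_pexp2l // leq_addr.
Qed.

Lemma poly_bounded_const c : poly_bounded (fun=> c).
Proof. by exists c, 0 => n; rewrite leq_addl. Qed.

Lemma poly_bounded_id : poly_bounded id.
Proof. by exists 1, 1 => n; rewrite expn1 mul1n leq_addr. Qed.

Lemma poly_boundedD g h : poly_bounded g -> poly_bounded h -> poly_bounded (fun n => g n + h n).
Proof.
move=> [a [k Hg]] [b [l Hh]]; exists (2 * (a + b)), (k + l) => n.
have := Hg n; have := Hh n; have := leq_expD1 n k l; have := leq_expD1 n l k; rewrite (addnC l k).
set x := n ^ k; set y := n ^ l; set z := n ^ (k + l) => hy hx ? ?.
have : a * x <= a * (z + 1) by rewrite leq_mul2l hx orbT.
have : b * y <= b * (z + 1) by rewrite leq_mul2l hy orbT.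
rewrite !mulnDr !mulnDl !muln1; lia.
Qed.

Lemma poly_boundedM g h : poly_bounded g -> poly_bounded h -> poly_bounded (fun n => g n * h n).
Proof.
move=> [a [k Hg]] [b [l Hh]]; exists (3 * (a * b)), (k + l) => n.
apply: leq_trans (leq_mul (Hg n) (Hh n)) _.
have := leq_expD1 n k l; have := leq_expD1 n l k; rewrite (addnC l k) expnD.
set x := n ^ k; set y := n ^ l => hy hx.
have -> : (a * x + a) * (b * y + b) = a * b * (x * y + x + y + 1) by ring.
have -> : 3 * (a * b) * (x * y) + 3 * (a * b) = a * b * (3 * (x * y) + 3) by ring.
by rewrite leq_mul2l; apply/orP; right; lia.
Qed.

Fixpoint pcost (p : prog) (n : nat) : nat :=
  match p with
  | PEmit _ | PInc => 1
  | PSkip => 0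
  | PSeq p q => pcost p n + pcost q n
  | PFor _ p => n * (pcost p n + 1) + 1
  | PIn _ p q | PCt _ p q => pcost p n + pcost q n + 2
  end.

Lemma pcost_poly p : poly_bounded (pcost p).
Proof.
elim: p => [b||p IHp q IHq|r p IHp|r p IHp q IHq|r p IHp q IHq|] /=;
  try (exact: poly_bounded_const); do 2?[apply: poly_boundedD => //];
  try (exact: poly_bounded_const).
apply: poly_boundedM; first exact: poly_bounded_id.
by apply: poly_boundedD => //; apply: poly_bounded_const.
Qed.

Section ProgramMachine.

Variable K : nat.

Lemma exec_cost w p rho c o c' s : exec K w p rho c o c' s -> s <= pcost p (size w).
Proof.
elim=> {p rho c o c' s} //=.
- by move=> *; apply: leq_add.
- move=> r p rho c o s _ _ _ IH; rewrite addn1 ltnS.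
  apply: (@leq_trans (\sum_(j < size w) (pcost p (size w) + 1))).
    by apply: leq_sum => j _; rewrite addn1 ltnS; apply: IH.
  by rewrite sum_nat_const card_ord.
- by move=> r p q rho c o c' s j _ _ _ _; case: nth => IH; lia.
- by move=> r p q rho c o c' s j _ _ _ _; case: (odd _) => IH; lia.
Qed.

Lemma exec_size w p rho c o c' s : exec K w p rho c o c' s -> size o <= s.
Proof.
elim=> {p rho c o c' s} //=.
- by move=> *; rewrite size_cat; apply: leq_add.
- move=> r p rho c o s _ _ _ IH; apply: leqW.
  elim: (size w) IH => [|n IHn] IH; first by rewrite big_ord0.
  rewrite flatten_iotaS size_cat big_ord_recr /=; apply: leq_add; last first.
    by apply: leqW; apply: IH.
  by apply: IHn => j lt; apply: IH; apply: ltnW.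
- by move=> *; lia.
- by move=> *; lia.
Qed.

Definition prints w p rho c o c' := exists s, exec K w p rho c o c' s.

Theorem program_computes p (f : seq bool -> seq bool) :
  (forall w, exists c', prints w p (fun=> None) 0 (f w) c') ->
  exists (M : TM) (a k : nat), tm_wf M /\ computes_in M f (fun n => a * n ^ k + a).
Proof.
move=> H; pose m := pcost p.
have [a [k bnd]] : poly_bounded (fun n => m n * (2 * (n + m n) + 6) + 4 * n + 6).
  have pm : poly_bounded m by apply: pcost_poly.
  apply: poly_boundedD (poly_bounded_const 6).
  apply: poly_boundedD; last by apply: poly_boundedM (poly_bounded_const 4) poly_bounded_id.
  apply: poly_boundedM => //; apply: poly_boundedD (poly_bounded_const 6).
  by apply: poly_boundedM (poly_bounded_const 2) (poly_boundedD poly_bounded_id pm).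
pose code := compile 0 p.
have lab : all (fun i => label i <= size code) code by rewrite size_compile; apply: (compile_labels 0 p).
exists (printer_tm K code), a, k; split; first exact: printer_tm_wf.
apply: (@printer_computes K code lab f m) => w; have [c' [s ex]] := H w.
  exists (cells K w (fun=> None) c').
  (* [m] only bounds the running time; the surplus steps are spent in the halted configuration. *)
  rewrite /m -(subnK (exec_cost ex)) addnC run_add.
  have Cat : code_at code 0 code by exists [::], [::]; rewrite cats0.
  rewrite (compile_correct ex [::] Cat) add0n -(size_compile 0 p) -/code.
  by rewrite /mrun; elim: (_ - _) => // t IH; rewrite iterS IH mstep_halted.
apply: leq_trans (bnd _); rewrite -/m.
have lef : size (f w) <= m (size w) by apply: leq_trans (exec_size ex) (exec_cost ex).
by rewrite !leq_add2r leq_mul2l !leq_add2r leq_mul2l leq_add2l lef !orbT.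
Qed.

End ProgramMachine.

(** * Binary expansions, least significant bit first *)

Definition bitv (m x : nat) : seq bool := mkseq (fun j => odd (x %/ 2 ^ j)) m.

Lemma bitvS m x : bitv m.+1 x = odd x :: bitv m x./2.
Proof.
rewrite /bitv /mkseq /= expn0 divn1; congr (_ :: _).
rewrite -[1]addn0 iotaDl -map_comp; apply: eq_map => j /=.
by rewrite add1n expnS divnMA divn2.
Qed.

Lemma bitv0 m : bitv m 0 = nseq m false.
Proof. by elim: m => // m IH; rewrite bitvS IH. Qed.

Lemma bitv_cat p q x y : x < 2 ^ p -> bitv (p + q) (x + 2 ^ p * y) = bitv p x ++ bitv q y.
Proof.
elim: p x => [|p IH] x; first by case: x => // _; rewrite mul1n.
rewrite expnS => lt; rewrite addSn !bitvS /= -IH; last by lia.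
by congr (_ :: bitv _ _); set z := 2 ^ p; lia.
Qed.

Lemma bits_fuelE f n : n <= f -> bits_fuel f n = bits n.
Proof.
rewrite /bits; elim/ltn_ind: n f => n IH f le.
case: n IH le => [|n] IH le; first by case: f {le}.
case: f le => // f le /=; congr (_ :: _).
by rewrite !IH //; lia.
Qed.

Lemma bitsE n : 0 < n -> bits n = odd n :: bits n./2.
Proof. by case: n => // n _; rewrite [in LHS]/bits /= bits_fuelE //; lia. Qed.

Lemma bits_cat p x y : x < 2 ^ p -> 0 < y -> bits (x + 2 ^ p * y) = bitv p x ++ bits y.
Proof.
elim: p x => [|p IH] x; first by case: x => // _; rewrite mul1n.
rewrite expnS => lt y0; have z0 : 0 < 2 ^ p * y by rewrite muln_gt0 expn_gt0.
rewrite bitsE ?bitvS /= -?IH //; try lia.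
by congr (_ :: bits _); rewrite -mulnA; set z := 2 ^ p * y; lia.
Qed.

(** * Printing games *)

Definition paired (l : seq bool) : seq bool := flatten [seq [:: true; b] | b <- l].

Lemma paired_cat l1 l2 : paired (l1 ++ l2) = paired l1 ++ paired l2.
Proof. by rewrite /paired map_cat flatten_cat. Qed.

Lemma flatten_map_flatten (A B : Type) (F : A -> seq B) ss :
  flatten (map F (flatten ss)) = flatten (map (fun s => flatten (map F s)) ss).
Proof. by elim: ss => //= s ss IH; rewrite map_cat flatten_cat IH. Qed.

Definition pemits (l : seq bool) : prog := foldr (fun b => PSeq (PEmit b)) PSkip l.
Definition pbits (l : seq bool) : prog := pemits (paired l).

(** Nested loops need different markers; [k] of them print [n ^ k] zeros. *)
Fixpoint pzeros_pow (k r : nat) : prog :=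
  if k is k'.+1 then PFor r (pzeros_pow k' r.+1) else pbits [:: false].

Fixpoint prepeat (m : nat) (p : prog) : prog :=
  if m is m'.+1 then PSeq p (prepeat m' p) else PSkip.

(* The digit [(false, c)] is the constant [c]; [(true, c)] is [c + 2 ^ kappa * i]
   where [i] is the current value of the counter. *)
Definition digit := (bool * nat)%type.

Definition zero_digit (d : digit) : bool := ~~ d.1 && (d.2 == 0).

Section Printing.

Variables (kappa a k : nat).

Definition pzeros : prog := PSeq (prepeat a (pzeros_pow k 1)) (pbits (nseq a false)).

(** Both forms fill the same [width]. The 4 spare bits let constants reach [2 ^ (kappa + 4)]; the
    polynomial padding is what makes the base exponentially large. *)
Definition pdigit (d : digit) : prog :=
  if d.1 then
    PSeq (pbits (bitv kappa d.2))
      (PSeq (PFor 1 (PCt 1 (pbits [:: true]) (pbits [:: false])))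
        (PSeq (pbits (nseq 4 false)) pzeros))
  else PSeq (pbits (bitv (kappa + 4) d.2)) (PSeq (PFor 1 (pbits [:: false])) pzeros).

Fixpoint pnum (ds : seq digit) : prog :=
  if ds is d :: ds' then
    if all zero_digit ds' then pbits (bits d.2) else PSeq (pdigit d) (pnum ds')
  else PSkip.

(** Which digit leads is decided when the program is built, and that digit is printed without
    leading zeros; so it must be a positive constant. Beside the counter a constant has only [kappa]
    bits, the counter coming right above them. *)
Fixpoint wf_num (ds : seq digit) : bool :=
  if ds is d :: ds' then
    if all zero_digit ds' then ~~ d.1 && (0 < d.2)
    else (d.2 < 2 ^ (kappa + if d.1 then 0 else 4)) && wf_num ds'
  else false.

Definition pitem (ds : seq digit) : prog :=
  PSeq (pemits [:: true; true]) (PSeq (pnum ds) (PEmit false)).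

Definition pitems (dss : seq (seq digit)) : prog := foldr (fun ds => PSeq (pitem ds)) PSkip dss.

(** [PInc] keeps the counter equal to the position of marker 0. After the loop it is [n], which fits
    into [n] bits because [n < 2 ^ n]. *)
Definition pgame (cds : seq (seq digit)) (bds : bool -> seq (seq digit)) (rds : seq (seq digit))
    (V : seq int) (xds : seq digit) : prog :=
  PSeq (pitems cds)
    (PSeq (PFor 0 (PSeq (PIn 0 (pitems (bds true)) (pitems (bds false))) PInc))
      (PSeq (pitems rds) (PSeq (pemits (false :: enc_list V ++ [:: false]))
        (PSeq (pnum xds) (PEmit false))))).

Definition width (n : nat) : nat := kappa + 4 + n + (a * n ^ k + a).

Definition dval (i : nat) (d : digit) : nat := d.2 + 2 ^ kappa * (d.1 * i).
Definition nval (n i : nat) (ds : seq digit) : nat :=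
  foldr (fun d v => dval i d + 2 ^ width n * v) 0 ds.

Definition game_moves (cds : seq (seq digit)) (bds : bool -> seq (seq digit))
    (rds : seq (seq digit)) (w : seq bool) : seq int :=
  [seq - Posz (nval (size w) 0 ds) | ds <- cds]%R ++
  flatten [seq [seq - Posz (nval (size w) j ds) | ds <- bds (nth false w j)]%R | j <- iota 0 (size w)] ++
  [seq - Posz (nval (size w) (size w) ds) | ds <- rds]%R.

Section Correctness.

Variable w : seq bool.
Let n := size w.

Let prints := prints k.+1 w.

Lemma prints_seq p q rho c1 o1 c2 o2 c3 : prints p rho c1 o1 c2 -> prints q rho c2 o2 c3 ->
  prints (PSeq p q) rho c1 (o1 ++ o2) c3.
Proof. by case=> s1 e1 [s2 e2]; exists (s1 + s2); apply: ESeq e1 e2. Qed.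

Lemma prints_emit b rho c : prints (PEmit b) rho c [:: b] c.
Proof. by exists 1; apply: EEmit. Qed.

Lemma prints_skip rho c : prints PSkip rho c [::] c.
Proof. by exists 0; apply: ESkip. Qed.

Lemma prints_emits l rho c : prints (pemits l) rho c l c.
Proof.
elim: l => [|b l IH]; first exact: prints_skip.
by rewrite -cat1s; apply: prints_seq IH; apply: prints_emit.
Qed.

Lemma prints_for r p rho (c : nat -> nat) o : r <= k.+1 -> rho r = None ->
  (forall j, j < n -> prints p (upd rho r (Some j)) (c j) (o j) (c j.+1)) ->
  prints (PFor r p) rho (c 0) (flatten (map o (iota 0 n))) (c n).
Proof.
move=> ler rN H.
(* The costs of the single iterations are collected into one function, as [EFor] requires. *)
have [s Hs] : exists s : nat -> nat, forall j, j < n -> exec k.+1 w p (upd rho r (Some j)) (c j) (o j) (c j.+1) (s j).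
  elim: n H => [|m IH] H; first by exists (fun=> 0).
  have [s Hs] := IH (fun j lt => H j (ltnW lt)); have [t Ht] := H m (ltnSn m).
  exists (fun j => if j == m then t else s j) => j lt; case: eqP => [->|ne] //.
  by apply: Hs; lia.
by exists (\sum_(j < n) (s j).+1).+1; apply: EFor.
Qed.

Lemma prints_in r p q rho c o c' j : r <= k.+1 -> rho r = Some j -> j < n ->
  prints (if nth false w j then p else q) rho c o c' -> prints (PIn r p q) rho c o c'.
Proof. by move=> ler rj ltj [s e]; exists (s + nth false w j).+1; apply: EIn ler rj ltj e. Qed.

Lemma prints_ct r p q rho c o c' j : r <= k.+1 -> rho r = Some j -> j < n ->
  prints (if odd (c %/ 2 ^ j) then p else q) rho c o c' -> prints (PCt r p q) rho c o c'.
Proof. by move=> ler rj ltj [s e]; exists (s + odd (c %/ 2 ^ j)).+1; apply: ECt ler rj ltj e. Qed.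

Lemma flatten_nseq (l : seq bool) m : flatten (map (fun=> paired l) (iota 0 m)) =
  paired (flatten (nseq m l)).
Proof.
elim: m => // m IH; rewrite flatten_iotaS IH -paired_cat -[m.+1]addn1 nseqD flatten_cat /=.
by rewrite cats0.
Qed.

Lemma flatten_nseq_nseq m1 m2 : flatten (nseq m1 (nseq m2 false)) = nseq (m1 * m2) false.
Proof. by elim: m1 => //= m1 ->; rewrite -nseqD mulSn. Qed.

Lemma prints_pzeros_pow j r rho c : (forall r', r <= r' -> rho r' = None) -> r + j <= k.+2 ->
  prints (pzeros_pow j r) rho c (paired (nseq (n ^ j) false)) c.
Proof.
elim: j r rho => [|j IH] r rho rN le /=; first exact: prints_emits.
rewrite expnS -flatten_nseq_nseq -flatten_nseq.
apply: (@prints_for _ _ _ (fun=> c)); [lia|exact: rN|move=> i _].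
by apply: IH => [r' ltr|]; [rewrite /upd (gtn_eqF ltr) rN // ltnW|lia].
Qed.

Lemma prints_repeat m p rho c l : prints p rho c (paired l) c ->
  prints (prepeat m p) rho c (paired (flatten (nseq m l))) c.
Proof.
move=> H; elim: m => [|m IH]; first exact: prints_skip.
by rewrite /= paired_cat; apply: prints_seq H IH.
Qed.

Section FreeMarkers.

Variable rho : env.
Hypothesis rho_free : forall r, 0 < r -> rho r = None.

Lemma prints_pzeros c : prints pzeros rho c (paired (nseq (a * n ^ k + a) false)) c.
Proof.
rewrite nseqD paired_cat; apply: prints_seq; last exact: prints_emits.
rewrite -flatten_nseq_nseq; apply: prints_repeat; apply: prints_pzeros_pow => //.
Qed.

Lemma paired_bitv m x : paired (bitv m x) = flatten (map (fun j => paired [:: odd (x %/ 2 ^ j)]) (iota 0 m)).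
Proof. by rewrite /paired /bitv /mkseq -map_comp; congr flatten; apply: eq_map. Qed.

Lemma prints_pdigit c d : c < 2 ^ n -> d.2 < 2 ^ (kappa + if d.1 then 0 else 4) ->
  prints (pdigit d) rho c (paired (bitv (width n) (dval c d))) c.
Proof.
move=> ltc; rewrite /pdigit /dval /width; case: d => -[] x /= ltx.
  rewrite addn0 in ltx; rewrite mul1n.
  rewrite -2!addnA bitv_cat // paired_cat; apply: prints_seq; first exact: prints_emits.
  rewrite addnCA; set z := 4 + _.
  have -> : bitv (n + z) c = bitv n c ++ bitv z 0 by rewrite -bitv_cat // muln0 addn0.
  rewrite paired_cat; apply: (prints_seq (c2 := c)); last first.
    by rewrite bitv0 nseqD paired_cat; apply: (prints_seq (c2 := c)); [apply: prints_emits|apply: prints_pzeros].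
  rewrite paired_bitv; apply: (@prints_for _ _ _ (fun=> c)); [by []|exact: rho_free|move=> j ltj].
  by apply: (prints_ct (j := j)) => //; case: odd; apply: prints_emits.
rewrite mul0n muln0 addn0 -addnA; set z := n + _.
have -> : bitv (kappa + 4 + z) x = bitv (kappa + 4) x ++ bitv z 0 by rewrite -bitv_cat // muln0 addn0.
rewrite paired_cat; apply: (prints_seq (c2 := c)); first exact: prints_emits.
rewrite bitv0 nseqD paired_cat; apply: (prints_seq (c2 := c)); last exact: prints_pzeros.
have -> : nseq n false = flatten (nseq n [:: false]) by rewrite (flatten_nseq_nseq n 1) muln1.
rewrite -flatten_nseq.
by apply: (@prints_for _ _ _ (fun=> c)); [by []|exact: rho_free|move=> j ltj; apply: prints_emits].
Qed.

Lemma dval_lt c d : c < 2 ^ n -> d.2 < 2 ^ (kappa + if d.1 then 0 else 4) -> dval c d < 2 ^ width n.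
Proof.
rewrite /dval /width; case: d => -[] x /= ltc ltx.
  apply: (@leq_trans (2 ^ (kappa + n))); last by rewrite leq_exp2l //; lia.
  rewrite addn0 in ltx; rewrite mul1n expnD.
  have : 2 ^ kappa * c + 2 ^ kappa <= 2 ^ kappa * 2 ^ n by rewrite addnC -mulnS leq_mul2l ltc orbT.
  lia.
rewrite mul0n muln0 addn0; apply: leq_trans ltx _; rewrite leq_exp2l //; lia.
Qed.

Lemma nval_zero c ds : all zero_digit ds -> nval n c ds = 0.
Proof.
elim: ds => //= -[b x] ds IH /andP[/andP[/= nb /eqP ->] /IH ->].
by rewrite /dval /= (negbTE nb) /=; lia.
Qed.

Lemma prints_pnum c ds : c < 2 ^ n -> wf_num ds ->
  prints (pnum ds) rho c (paired (bits (nval n c ds))) c /\ 0 < nval n c ds.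
Proof.
move=> ltc; elim: ds => //= d ds IH; case: ifP => [az /andP[nd pos]|_ /andP[ltd /IH[pr pos]]].
  rewrite nval_zero // muln0 addn0 /dval (negbTE nd) mul0n muln0 addn0.
  by split => //; apply: prints_emits.
split; last by rewrite ltn_addl // muln_gt0 expn_gt0.
rewrite bits_cat ?dval_lt // paired_cat; apply: prints_seq pr; exact: prints_pdigit.
Qed.

Lemma enc_int_neg x : 0 < x -> enc_int (- Posz x)%R = true :: paired (bits x) ++ [:: false].
Proof. by move=> x0; rewrite /enc_int /enc_nat abszN /= (_ : (- Posz x < 0)%R = true) //; lia. Qed.

Lemma prints_pitems c dss : c < 2 ^ n -> all wf_num dss ->
  prints (pitems dss) rho c
    (flatten [seq true :: enc_int z | z <- [seq - Posz (nval n c ds) | ds <- dss]%R]) c.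
Proof.
move=> ltc; elim: dss => [|ds dss IH]; first by move=> _; apply: prints_skip.
move=> /andP[wf /IH pr]; have [prd pos] := prints_pnum ltc wf.
have -> (z : int) s : flatten [seq true :: enc_int z | z <- z :: s] =
  (true :: enc_int z) ++ flatten [seq true :: enc_int z | z <- s] by [].
rewrite enc_int_neg // -/(map _ dss).
apply: (prints_seq (o1 := [:: true, true & paired (bits (nval n c ds)) ++ [:: false]]) _ pr).
apply: (prints_seq (o1 := [:: true; true])); first exact: prints_emits.
by apply: prints_seq prd _; apply: prints_emit.
Qed.

End FreeMarkers.

Lemma prints_pgame cds bds rds V xds :
  all wf_num cds -> (forall b, all wf_num (bds b)) -> all wf_num rds -> wf_num xds ->
  prints (pgame cds bds rds V xds) (fun=> None) 0
    (enc_game (game_moves cds bds rds w) V (Posz (nval n n xds))) n.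
Proof.
move=> wfc wfb wfr wfx; have ltn2 : n < 2 ^ n by apply: ltn_expl.
have [prx posx] := prints_pnum (rho := fun=> None) (fun _ _ => erefl) ltn2 wfx.
rewrite /enc_game /game_moves /enc_list !map_cat !flatten_cat -!catA.
apply: prints_seq; first by apply: prints_pitems => //; rewrite expn_gt0.
apply: prints_seq.
  rewrite flatten_map_flatten -map_comp.
  apply: (@prints_for _ _ _ id) => // j ltj; rewrite -[X in prints _ _ _ X]cats0.
  apply: (prints_seq (c2 := j)); last by exists 1; apply: EInc.
  apply: (prints_in (j := j)) => //.
  have -> : (if nth false w j then pitems (bds true) else pitems (bds false)) = pitems (bds (nth false w j)).
    by case: nth.
  by apply: prints_pitems => //; [case|apply: ltn_trans ltn2].
apply: prints_seq; first exact: prints_pitems.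
move: prx; set x := nval n n xds => prx.
have -> : enc_int (Posz x) = [:: false] ++ paired (bits x) ++ [:: false] by [].
set v := flatten _.
have -> : [:: false] ++ v ++ [:: false] ++ [:: false] ++ paired (bits x) ++ [:: false] =
  (false :: enc_list V ++ [:: false]) ++ paired (bits x) ++ [:: false].
  by rewrite /enc_list /= -!catA.
apply: (prints_seq (c2 := n)); first exact: prints_emits.
by apply: prints_seq prx _; apply: prints_emit.
Qed.

End Correctness.

End Printing.

(** * The reduction *)

Lemma bits_inj : injective bits.
Proof.
elim/ltn_ind=> -[|m] IH [|k] //; rewrite ?(bitsE (ltn0Sn _)) //.
case=> eo E; have lt : (m.+1)./2 < m.+1 by lia.
by have := IH _ lt _ E; move: eo => /=; lia.
Qed.

Lemma paired_inj l l' s t : paired l ++ false :: s = paired l' ++ false :: t -> l = l' /\ s = t.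
Proof.
elim: l l' => [|b l IH] [|c l'] //=; first by case.
by case=> -> /IH[-> ->].
Qed.

Lemma enc_nat_inj m k s t : enc_nat m ++ s = enc_nat k ++ t -> m = k /\ s = t.
Proof. by rewrite /enc_nat -!catA /= => /paired_inj[/bits_inj -> ->]. Qed.

Lemma enc_int_inj x y s t : enc_int x ++ s = enc_int y ++ t -> x = y /\ s = t.
Proof.
rewrite /enc_int !cat_cons; case=> sg /enc_nat_inj[ab ->]; split => //.
by move: sg ab; lia.
Qed.

Lemma enc_list_inj l l' s t : enc_list l ++ s = enc_list l' ++ t -> l = l' /\ s = t.
Proof.
rewrite /enc_list -!catA /=.
elim: l l' => [|x l IH] [|y l']; rewrite /= ?cat_cons; try by case.
rewrite -!catA; case=> sg /paired_inj[/bits_inj ab /IH[-> ->]]; split => //; congr (_ :: _).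
by move: sg ab; lia.
Qed.

(** [ROBOT1] quantifies over all games with a given encoding, so the reduction must recover its own
    game from the word. *)
Lemma enc_game_inj U V x U' V' x' : enc_game U V x = enc_game U' V' x' ->
  [/\ U = U', V = V' & x = x'].
Proof.
rewrite /enc_game => /enc_list_inj[-> /enc_list_inj[->]].
by rewrite -[enc_int x]cats0 -[enc_int x']cats0 => /enc_int_inj[-> _].
Qed.

(** * Moves as numerals in base [b] *)

Lemma mag_split (N lB D ld cm m0 r1 r2 r3 r4 r5 A cd : nat) : cm + N * m0 = A + cd ->
  (D + ld) * lB + cm + N * (m0 + r1 + r2 + r3 + r4 + r5) =
  A + D * lB + N * (r1 + r2 + r3 + r4 + r5) + (ld * lB + cd).
Proof.
move=> E; transitivity ((D + ld) * lB + (cm + N * m0) + N * (r1 + r2 + r3 + r4 + r5)); first by ring.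
by rewrite E; ring.
Qed.

Lemma digits_split (N b e D A r x1 x2 x3 x4 tau i : nat) : b = 8 * N * e ->
  8 * A + tau + 8 * N * r +
    b * (x1 + 8 * N * (false * i) + b * (8 * N * x2 + 8 * N * (false * i) + b * (x3 + 8 * N * x4 + 8 * N * (false * i) +
    b * (0 + 8 * N * (false * i) + b * (8 * N * D + 8 * N * (false * i) + b * 0))))) =
  8 * (A + D * (N * b ^ 5) + N * (r + x1 * e + x2 * b ^ 2 + x3 * (b ^ 2 * e) + x4 * (b * b ^ 2))) + tau.
Proof. by rewrite (_ : false * i = 0) // => ->; ring. Qed.

Lemma digit_bounds (N x1 x2 x3 x4 x5 : nat) : 0 < N -> x1 <= 4 -> x2 <= 1 -> x3 <= 2 -> x4 <= 1 -> x5 <= 2 ->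
  [&& x1 < 128 * N, 8 * N * x2 < 128 * N, x3 + 8 * N * x4 < 128 * N, 0 < 128 * N, 8 * N * x5 < 128 * N & true].
Proof.
move=> N0 l1 l2 l3 l4 l5.
have : N * x2 <= N * 1 by rewrite leq_mul2l l2 orbT.
have : N * x4 <= N * 1 by rewrite leq_mul2l l4 orbT.
have : N * x5 <= N * 2 by rewrite leq_mul2l l5 orbT.
by rewrite -!mulnA => *; do ?[apply/andP; split]; lia.
Qed.

Arguments modulus : simpl never.
Arguments code : simpl never.

Section MoveDigits.

Variable G : finType.
Variables (g : G -> G -> G -> G) (sstart sblk : G) (sbit : bool -> G).

Variable N : nat.
Hypothesis NE : N = modulus G.

Definition kappa := 3 + 4 * nranks G.

Lemma kappaE : 2 ^ kappa = 8 * N.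
Proof.
rewrite /kappa expnD expnM NE /modulus (_ : 2 ^ 3 = 8) // (_ : 2 ^ 4 = 16) //.
Qed.

(** Digits of [8 * mmag + tau] for [Q = b ^ 2], [T = b ^ 3], [B = N * b ^ 5]. As [8 * N * e = b], a
    multiple of [e] becomes a plain constant one digit higher; this is why [mQe] shares digit 3 with
    [mT]. *)
Definition digits (tau : nat) (m : move G) : seq digit :=
  [:: (mi m, 8 * (code (msrc m) + N * m0 m - odflt0 (@code G) (mdst m)) + tau);
      (false, me m); (false, 8 * N * mQ m); (false, mQe m + 8 * N * mT m); (false, 0);
      (false, 8 * N * (level (msrc m) - odflt0 (@level G) (mdst m)))].

(** The first group makes the digits fit and the second excludes truncated subtraction. The last
    clause makes the number nonzero; for a counter digit it also keeps the constant below
    [2 ^ kappa] and provides a nonzero digit above. *)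
Definition tame (m : move G) : bool :=
  [&& m0 m <= 5, me m <= 4, mQ m <= 1, mQe m <= 2 & mT m <= 1] &&
  [&& odflt0 (@level G) (mdst m) <= level (msrc m),
      odflt0 (@code G) (mdst m) <= code (msrc m) + N * m0 m &
      if mi m then (m0 m == 0) && (0 < me m)
      else [|| mdst m == None, 0 < m0 m | odflt0 (@level G) (mdst m) < level (msrc m)]].

Lemma code_ltN (s : gstate G) : code s < N.
Proof. by rewrite NE code_lt. Qed.

Lemma tame_step s t j qQ qT : 0 < j <= 5 -> qQ <= 1 -> qT <= 1 -> level s = level t ->
  tame (Move s (Some t) j false 0 qQ 0 qT).
Proof.
move=> /andP[j0 j5] q1 t1 l; rewrite /tame /= j5 q1 t1 l leqnn j0 /= andbT.
by apply: leq_trans (ltnW (code_ltN t)) _; apply: leq_trans (leq_addl _ _); rewrite leq_pmulr.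
Qed.

Lemma run_moves_tame d : d < 3 -> all tame (run_moves g sstart sblk sbit d).
Proof.
move=> lt3; rewrite /run_moves.
rewrite all_cat; apply/andP; split.
  by apply/allP => m /flatten_mapP[p _ /mapP[q _ ->]]; apply: tame_step => //; lia.
rewrite all_cat; apply/andP; split.
  by apply/allP => m /flatten_mapP[p _ /mapP[q _ ->]]; apply: tame_step => //; lia.
rewrite all_cat; apply/andP; split.
  by apply/allP => m /mapP[p _ ->]; apply: tame_step => //; lia.
rewrite all_cat; apply/andP; split.
  by apply/allP => m /mapP[p _ ->]; rewrite /tame /=; lia.
rewrite all_cat; apply/andP; split.
  apply/allP => m /flatten_mapP[p _ /mapP[j jin ->]]; apply: tame_step => //.
  by move: jin; rewrite !inE => /orP[]/eqP->.
rewrite all_cat; apply/andP; split.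
  by apply/allP => m /mapP[p _ ->].
rewrite all_cat; apply/andP; split.
  by apply/allP => m /mapP[p _ ->]; apply: tame_step.
by apply/allP => m /mapP[p _ ->].
Qed.

Lemma const_moves_tame tau : tau < 5 -> all tame (const_moves g sstart sblk sbit tau).
Proof.
move=> lt5; rewrite /const_moves; case: ltnP => [lt3|_]; first exact: run_moves_tame.
rewrite /check_moves all_cat; apply/andP; split.
  apply/allP => m /mapP[s sin ->]; rewrite /tame /= muln0 addn0.
  have -> : level s = 2 by move: sin; rewrite !mem_cat => /or3P[]/mapP[? _ ->].
  rewrite /code leq_exp2l //= andbT.
  by move: sin; rewrite !mem_cat => /or3P[]/mapP[x _ ->] /=; case: (_ == _); lia.
rewrite all_cat; apply/andP; split.
  by apply/allP => m /mapP[p _ ->]; apply: tame_step.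
by apply/allP => m /mapP[p _ ->].
Qed.

Lemma bit_moves_tame tau b : all tame (bit_moves G tau b).
Proof. by rewrite /bit_moves; case: ifP. Qed.

Lemma blank_moves_tame tau : all tame (blank_moves G tau).
Proof. by rewrite /blank_moves; case: ifP. Qed.

(** Without counter digits the leading nonzero digit is automatically a positive constant. *)
Lemma nval_zero_free ds : ~~ all zero_digit ds -> all (fun d => ~~ d.1 && (d.2 < 2 ^ (kappa + 4))) ds ->
  wf_num kappa ds.
Proof.
elim: ds => //= d ds IH nz /andP[/andP[nd lt] al].
case: ifP => az; first by move: nz; rewrite az andbT /zero_digit nd /= lt0n.
by rewrite (negbTE nd) lt IH // az.
Qed.

Lemma wf_num_cons d ds : wf_num kappa (d :: ds) =
  if all zero_digit ds then ~~ d.1 && (0 < d.2)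
  else (d.2 < 2 ^ (kappa + if d.1 then 0 else 4)) && wf_num kappa ds.
Proof. by []. Qed.

Lemma wf_digits tau m : tau < 5 -> tame m -> wf_num kappa (digits tau m).
Proof.
move=> lt5 /andP[/and5P[h0 he hQ hQe hT] /and3P[hl hc hm]].
have N0 : 0 < N by rewrite NE /modulus expn_gt0.
have cs : code (msrc m) < N := code_ltN _.
have ls : level (msrc m) <= 2 by case: (msrc m).
have k4 : 2 ^ (kappa + 4) = 128 * N by rewrite expnD kappaE mulnAC.
have tail : all (fun d : digit => ~~ d.1 && (d.2 < 2 ^ (kappa + 4))) (behead (digits tau m)).
  have le2 : level (msrc m) - odflt0 (@level G) (mdst m) <= 2 by lia.
  by rewrite /digits /= k4; apply: digit_bounds.
have cm : code (msrc m) + N * m0 m - odflt0 (@code G) (mdst m) < 6 * N.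
  have : N * m0 m <= N * 5 by rewrite leq_mul2l h0 orbT.
  lia.
pose d0 : digit := (mi m, 8 * (code (msrc m) + N * m0 m - odflt0 (@code G) (mdst m)) + tau).
pose D := behead (digits tau m).
have -> : digits tau m = d0 :: D by [].
case E : (mi m) hm => hm.
  move: hm => /andP[/eqP m00 me0].
  have nzD : ~~ all zero_digit D.
    apply/negP => /andP[z _]; move: z; rewrite /zero_digit /= => /eqP z.
    by rewrite z in me0.
  rewrite wf_num_cons (negbTE nzD) (nval_zero_free nzD tail) andbT [d0.1]/= E addn0 kappaE [d0.2]/= m00 muln0 addn0.
  by move: cs lt5; lia.
apply: nval_zero_free; last first.
  apply/andP; split; last exact: tail.
  by rewrite [d0.1]/= E k4 [d0.2]/=; lia.
apply/negP => /andP[]; rewrite {1}/zero_digit [d0.1]/= E [d0.2]/= => z0 zD.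
have zl : 8 * N * (level (msrc m) - odflt0 (@level G) (mdst m)) = 0.
  by move: zD; rewrite /D /digits /= /zero_digit /= => /and4P[_ _ _ /andP[/eqP ->]].
have {}z0 : code (msrc m) + N * m0 m - odflt0 (@code G) (mdst m) = 0 by lia.
case/or3P: hm => [/eqP md|m00|lt].
- by have := code_gt0 (msrc m); move: z0; rewrite md /=; lia.
- have : N <= N * m0 m by rewrite leq_pmulr.
  case: (mdst m) z0 => [t|] /=; last by lia.
  by have := code_ltN t; lia.
- move: zl; rewrite -mulnA; have : 0 < N * (level (msrc m) - odflt0 (@level G) (mdst m)).
    by rewrite muln_gt0 N0 subn_gt0.
  lia.
Qed.

Section Values.

Variables a k n : nat.
Let e := 2 ^ (4 + n + (a * n ^ k + a)).
Let b := 2 ^ width kappa a k n.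
Let B := N * b ^ 5.

Lemma digit_baseE : b = 8 * N * e.
Proof. by rewrite /b /width /e -kappaE -expnD !addnA. Qed.

Lemma nval_digits tau i m : tame m ->
  nval kappa a k n i (digits tau m) = 8 * mmag e (b ^ 2) (b * b ^ 2) B i m + tau.
Proof.
case/andP => _ /and3P[lev cod _].
have [A EA] : exists A, code (msrc m) + N * m0 m = A + odflt0 (@code G) (mdst m).
  by exists (code (msrc m) + N * m0 m - odflt0 (@code G) (mdst m)); rewrite subnK.
have [D ED] : exists D, level (msrc m) = D + odflt0 (@level G) (mdst m).
  by exists (level (msrc m) - odflt0 (@level G) (mdst m)); rewrite subnK.
rewrite /mmag /mag /mshift -NE /nval /digits /= /dval EA ED !addnK kappaE /= -/b.
rewrite (mag_split _ _ _ _ _ _ _ _ EA) addnK.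
by apply: digits_split; apply: digit_baseE.
Qed.

End Values.

End MoveDigits.

Section Reduction.

Variables (G : finType) (a k : nat).
Variables (g : G -> G -> G -> G) (sstart sblk : G) (sbit : bool -> G) (sacc : G).

Variable N : nat.
Hypothesis NE : N = modulus G.

Definition const_digits : seq (seq digit) :=
  flatten [seq [seq digits N tau m | m <- const_moves g sstart sblk sbit tau] | tau <- iota 0 5].
Definition bit_digits (b : bool) : seq (seq digit) :=
  flatten [seq [seq digits N tau m | m <- bit_moves G tau b] | tau <- iota 0 5].
Definition blank_digits : seq (seq digit) :=
  flatten [seq [seq digits N tau m | m <- blank_moves G tau] | tau <- iota 0 5].
(** Digit 4, which is 0 in every move, holds [T * e], since [8 * N * (b ^ 3 * e) = b ^ 4]. *)
Definition start_digits : seq digit :=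
  [:: (false, 8 * code (ST (false, (sacc, sacc, sacc))) + 8 * N * 4); (false, 6); (false, 0);
      (false, 2); (false, 1); (false, 8 * N * 2)].

Definition opponent_moves : seq int := [:: 0; 1; 2; 3; 4]%R.

Definition reducer : prog :=
  pgame (kappa G) a k const_digits bit_digits blank_digits opponent_moves start_digits.

Lemma digits_flatten_wf (F : nat -> seq (move G)) :
  (forall tau, tau < 5 -> all (tame N) (F tau)) ->
  all (wf_num (kappa G)) (flatten [seq [seq digits N tau m | m <- F tau] | tau <- iota 0 5]).
Proof.
move=> H; apply/allP => ds /flatten_mapP[tau]; rewrite mem_iota => lt5 /mapP[m min ->].
by apply: (wf_digits NE lt5); apply: (allP (H _ lt5)).
Qed.

Lemma start_digits_wf : wf_num (kappa G) start_digits.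
Proof.
have N0 : 0 < N by rewrite NE /modulus expn_gt0.
have k4 : 2 ^ (kappa G + 4) = 128 * N by rewrite expnD (kappaE NE) mulnAC.
have c1 : 8 * code (ST (false, (sacc, sacc, sacc))) + 8 * N * 4 < 128 * N.
  by have := code_ltN NE (ST (false, (sacc, sacc, sacc))); lia.
apply: nval_zero_free.
  rewrite /start_digits; move: c1; case: (N) N0 => // N' _ _.
  by rewrite /= /zero_digit /= !andbF.
rewrite /start_digits /= k4; move: c1; case: (N) N0 => // N' _ ->.
by rewrite /=; do ?[apply/andP; split]; lia.
Qed.

Section Word.

Variable w : seq bool.
Let n := size w.
Variables (e b : nat).
Hypothesis eE : e = 2 ^ (4 + n + (a * n ^ k + a)).
Hypothesis bE : b = 2 ^ width (kappa G) a k n.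

Definition reacher_moves : seq int :=
  game_moves (kappa G) a k const_digits bit_digits blank_digits w.
Definition initial_value : int := Posz (nval (kappa G) a k n n start_digits).

Lemma reducer_prints : prints k.+1 w reducer (fun=> None) 0
  (enc_game reacher_moves opponent_moves initial_value) n.
Proof.
apply: prints_pgame.
- by apply: digits_flatten_wf => tau lt5; apply: (const_moves_tame _ _ _ _ NE lt5).
- by move=> c; apply: digits_flatten_wf => tau lt5; apply: (bit_moves_tame G N tau c).
- by apply: digits_flatten_wf => tau lt5; apply: (blank_moves_tame G N tau).
- exact: start_digits_wf.
Qed.

Let menu := tableau_menu g sstart sblk sbit e (b ^ 2) (b * b ^ 2) (N * b ^ 5) w.

Lemma reacher_movesP (u : int) : u \in reacher_moves <->
  exists tau m, [/\ tau < 5, m \in menu tau & u = (- Posz (8 * m + tau))%R].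
Proof.
have valE tau i (m : move G) : tame N m -> nval (kappa G) a k n i (digits N tau m) =
    8 * mmag e (b ^ 2) (b * b ^ 2) (N * b ^ 5) i m + tau.
  by move=> tm; rewrite (nval_digits NE) // -eE -bE.
have ctame tau m : tau < 5 -> m \in const_moves g sstart sblk sbit tau -> tame N m.
  by move=> lt5; apply: (allP (const_moves_tame g sstart sblk sbit NE lt5)).
have btame tau c m : m \in bit_moves G tau c -> tame N m by apply: (allP (bit_moves_tame G N tau c)).
have rtame tau m : m \in blank_moves G tau -> tame N m by apply: (allP (blank_moves_tame G N tau)).
split.
- rewrite /reacher_moves /game_moves !mem_cat => /or3P[].
  + case/mapP=> ds /flatten_mapP[tau]; rewrite mem_iota => lt5 /mapP[m min ->] ->.
    exists tau, (mmag e (b ^ 2) (b * b ^ 2) (N * b ^ 5) 0 m); split => //.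
      by rewrite /menu /tableau_menu mem_cat map_f.
    by rewrite valE //; apply: ctame min.
  + case/flatten_mapP=> j; rewrite mem_iota => ltj /mapP[ds /flatten_mapP[tau]].
    rewrite mem_iota => lt5 /mapP[m min ->] ->.
    exists tau, (mmag e (b ^ 2) (b * b ^ 2) (N * b ^ 5) j m); split => //.
      rewrite /menu /tableau_menu !mem_cat; apply/or3P; apply: Or32.
      by apply/flatten_mapP; exists j; rewrite ?mem_iota // map_f.
    by rewrite valE //; apply: btame min.
  + case/mapP=> ds /flatten_mapP[tau]; rewrite mem_iota => lt5 /mapP[m min ->] ->.
    exists tau, (mmag e (b ^ 2) (b * b ^ 2) (N * b ^ 5) n m); split => //.
      by rewrite /menu /tableau_menu !mem_cat map_f ?orbT.
    by rewrite valE //; apply: rtame min.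
case=> tau [m [lt5 min ->]]; rewrite /reacher_moves /game_moves !mem_cat.
have lt5' : tau \in iota 0 5 by rewrite mem_iota.
move: min; rewrite /menu /tableau_menu !mem_cat => /or3P[].
- case/mapP=> mv mvin ->; apply/or3P; apply: Or31.
  rewrite -valE; last exact: ctame mvin.
  apply/mapP; exists (digits N tau mv); last by [].
  by apply/flatten_mapP; exists tau => //; apply: map_f.
- case/flatten_mapP=> j jin /mapP[mv mvin ->]; apply/or3P; apply: Or32.
  apply/flatten_mapP; exists j => //; rewrite -valE; last exact: btame mvin.
  apply/mapP; exists (digits N tau mv); last by [].
  by apply/flatten_mapP; exists tau => //; apply: map_f.
- case/mapP=> mv mvin ->; apply/or3P; apply: Or33.
  rewrite -valE; last exact: rtame mvin.
  apply/mapP; exists (digits N tau mv); last by [].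
  by apply/flatten_mapP; exists tau => //; apply: map_f.
Qed.

Lemma initial_valueE : initial_value = Posz (8 * start_value e (b ^ 2) b (b ^ 5) sacc).
Proof.
have be : b = 8 * N * e by rewrite bE eE; exact: digit_baseE NE a k n.
rewrite /initial_value /start_value /base /levelo /codeo /nval /start_digits /= /dval /= -bE -NE.
apply: congr1; rewrite !mul0n !muln0 !addn0; move: (code _) => c.
transitivity (16 * (N * b ^ 5) + 8 * c + 6 * (8 * N * e) + 32 * N + b * b ^ 2 * (8 * N * e) +
  2 * b ^ 2 * (8 * N * e)); last by ring.
by rewrite -be; ring.
Qed.

Let T := b * b ^ 2.

(** The separation hypotheses of the tableau game for [rho = b], [Q = b ^ 2], [B' = b ^ 5]; all
    follow from [128 * e <= b], which holds because [N >= 16]. *)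
Lemma digit_base_bounds : [/\ 0 < e, 16 * e <= b, 8 * (b * e) <= b ^ 2 &
  T * e + 16 * e + 2 * (b ^ 2 * e) < b ^ 5].
Proof.
have e0 : 0 < e by rewrite eE expn_gt0.
have N16 : 16 <= N.
  by rewrite NE /modulus -[leqLHS]expn1 leq_exp2l // /nranks addSn.
have be : b = 8 * N * e by rewrite bE eE; exact: digit_baseE NE a k n.
have le128 : 128 * e <= b by rewrite be leq_mul2r; apply/orP; right; lia.
have eb : e <= b by lia.
have b128 : 128 <= b by lia.
have le2 : 128 * (b * e) <= b ^ 2 by rewrite mulnCA -mulnn leq_mul2l le128 orbT.
split; rewrite ?(leq_trans _ le128) ?leq_mul2r ?orbT //; first by lia.
have -> : b ^ 5 = b ^ 2 * (b * b ^ 2) by rewrite -expnS -expnD.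
have -> : T * e = b ^ 2 * (b * e) by rewrite /T; ring.
set B2 := b ^ 2 in le2 *.
have B2b : b <= B2 by rewrite /B2 -mulnn leq_pmulr //; lia.
have : B2 * e <= B2 * (b * e) by rewrite leq_mul2l leq_pmull ?orbT //; lia.
have : B2 * (128 * (b * e)) <= B2 * B2 by rewrite leq_mul2l le2 orbT.
have : B2 * B2 <= B2 * (b * B2) by rewrite leq_mul2l leq_pmull ?orbT //; lia.
have : e <= B2 * e by rewrite leq_pmull //; lia.
have : 0 < B2 * (b * e) by rewrite !muln_gt0 e0; lia.
rewrite [B2 * (128 * _)]mulnCA; set X := B2 * (b * e); set Y := B2 * e; lia.
Qed.

Lemma size_le_base : n <= e.
Proof.
apply: ltnW; apply: leq_trans (ltn_expl n (ltnSn 1)) _.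
by rewrite eE leq_exp2l //; lia.
Qed.

Lemma reduction_win : tab_row3 g sstart sblk sbit w e 0 = (sacc, sacc, sacc) ->
  winning reacher_moves opponent_moves initial_value.
Proof.
have [e0 le1 le2 le3] := digit_base_bounds; move: reacher_movesP; rewrite /menu NE => U_menu.
rewrite initial_valueE.
exact: (tableau_win e0 size_le_base le1 le2 le3 U_menu).
Qed.

Lemma reduction_lose : tab_row g sstart sblk sbit w e 0 <> sacc ->
  ~ winning reacher_moves opponent_moves initial_value.
Proof.
have [e0 le1 le2 le3] := digit_base_bounds; move: reacher_movesP; rewrite /menu NE => U_menu.
rewrite initial_valueE.
exact: (tableau_lose e0 size_le_base le1 le2 le3 U_menu).
Qed.

End Word.

End Reduction.

Theorem theorem16 : EXPTIME_hard ROBOT1.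
Proof.
move=> L [M [a [k [M_wf dec]]]].
(* Naming the modulus keeps this power of 16 from being unfolded. *)
have [N NE] : exists N, N = modulus (cell M) by eexists.
pose U := reacher_moves a k (@crule M) (cstart M) (cblank M) (@cbit M) N.
pose x0 w := initial_value a k (cacc M) N w.
have := @program_computes k.+1 (reducer a k (@crule M) (cstart M) (cblank M) (@cbit M) (cacc M) N)
  (fun w => enc_game (U w) opponent_moves (x0 w)).
case=> [w|M' [a' [k' [M'_wf comp]]]]; first by exists (size w); apply: reducer_prints.
exists M', (fun w => enc_game (U w) opponent_moves (x0 w)), a', k'; split => // w.
have [e eE] : exists e, e = 2 ^ (4 + size w + (a * size w ^ k + a)) by eexists.
have [b bE] : exists b, b = 2 ^ width (kappa (cell M)) a k (size w) by eexists.
(* The summand 4 in the exponent of [e] leaves room for the factor 2 and the added 2, both due to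
   the spreading of acceptance. *)
have e_ge : 2 * 2 ^ (a * size w ^ k + a) + 2 <= e.
  rewrite eE [leqRHS]expnD; set T0 := 2 ^ (_ + a).
  have : 16 <= 2 ^ (4 + size w) by rewrite -[16]/(2 ^ 4) leq_exp2l // leq_addr.
  have : 0 < T0 by rewrite expn_gt0.
  move=> T00 le16; have : 16 * T0 <= 2 ^ (4 + size w) * T0 by rewrite leq_mul2r le16 orbT.
  lia.
have [halt accE] := dec w.
have win_iff : L w <-> winning (U w) opponent_moves (x0 w).
  rewrite -accE; case: halt => /eqP q; rewrite q; split => //.
  - by move=> _; apply: (reduction_win NE eE bE); apply: tab_row_accept q.
  - move=> win; case: (@reduction_lose _ a k (@crule M) (cstart M) (cblank M) (@cbit M) (cacc M) N NE w e b eE bE _ win).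
    by apply: tab_row_reject q.
rewrite win_iff; split=> [win|[U' [V' [x' [_ _ /enc_game_inj[-> -> ->]]]]]] //.
exists (U w), opponent_moves, (x0 w); split => //.
(* The reacher's moves are nonempty because a winning strategy returns one. *)
by case: win => sigma [Us _]; apply/eqP => U0; have := Us [::]; rewrite U0.
Qed.
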